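(* Let $\nu>0$ and let $\tilde\omega_0\in B_0$, where $B_0$ is either $B_0(\mathbb{R})$ or $B_0(\mathbb{S})$. Assume $\|\tilde\omega_0\|_{B_0}<\nu/4$. Then there exists $\tilde\omega\in\mathcal{B}_0$ (the corresponding space, $\mathcal{B}_0(\mathbb{R})$ or $\mathcal{B}_0(\mathbb{S})$) which is a global mild solution of $\tilde\omega_t=\tilde\omega\,\mathcal{H}\tilde\omega-\nu\tilde\omega$, $\tilde\omega(\cdot,0)=\tilde\omega_0$, i.e. for all $t\ge 0$, $$\tilde\omega(\cdot,t)=e^{-\nu t}\tilde\omega_0+\int_0^t e^{-\nu(t-s)}\,\tilde\omega(\cdot,s)\,\mathcal{H}(\tilde\omega)(\cdot,s)\,ds .$$
   Context: $\mathbb{S}$ denotes the circle $[-\pi,\pi]$ with periodic identification. $\mathcal{H}$ is the Hilbert transform, with Fourier symbol $-\mathrm{i}\,\mathrm{sgn}(k)$ (on $\mathbb{S}$ it is $\mathcal{H}f(x)=\frac{1}{2\pi}\mathrm{PV}\int_{-\pi}^{\pi}f(x')\cot\frac{x-x'}{2}dx'$). $B_0(\mathbb{R})$ is the Wiener algebra of functions whose Fourier transform lies in $L^1$, with norm $\int_{\mathbb{R}}|\hat f(\xi)|d\xi$; $B_0(\mathbb{S})$ is the space of periodic functions with Fourier coefficients in $\ell^1$, with norm $\sum_{k\in\mathbb{Z}}|\hat f(k)|$. The space-time spaces have norms $\|f\|_{\mathcal{B}_0(\mathbb{R})}=\int_{\mathbb{R}}\sup_{t\in[0,\infty)}|\hat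 f(\xi,t)|\,d\xi$ and $\|f\|_{\mathcal{B}_0(\mathbb{S})}=\sum_{k\in\mathbb{Z}}\sup_{t\in[0,\infty)}|\hat f(k,t)|$, where hats denote the spatial Fourier transform/coefficients. *)

(* Defs.v *)
From mathcomp Require Import all_boot all_order all_algebra.
From mathcomp Require Import all_classical all_reals all_analysis.
From mathcomp Require Import measurable_realfun complex.
Import Order.TTheory GRing.Theory Num.Theory.

Set Implicit Arguments.
Unset Strict Implicit.
Unset Printing Implicit Defensive.

Local Open Scope classical_set_scope.
Local Open Scope ring_scope.
Local Open Scope complex_scope.

Section Defs.
Variable R : realType.

Definition cmod (z : R[i]) : R := Num.sqrt (complex.Re z ^+ 2 + complex.Im z ^+ 2).

Definition cexpi (theta : R) : R[i] := (cos theta)%:C + 'i * (sin theta)%:C.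

Definition cintegrable (D : set R) (f : R -> R[i]) : Prop :=
  (@lebesgue_measure R).-integrable D (fun x => (complex.Re (f x))%:E) /\
  (@lebesgue_measure R).-integrable D (fun x => (complex.Im (f x))%:E).

Definition cint (D : set R) (f : R -> R[i]) : R[i] :=
  (Rintegral (@lebesgue_measure R) D (fun x => complex.Re (f x)))%:C +
  'i * (Rintegral (@lebesgue_measure R) D (fun x => complex.Im (f x)))%:C.

(** sum over Z of a complex family (limit of the partial sums
    sum_{-N <= k < N}); only used for absolutely summable families *)
Definition zsum (f : int -> R[i]) : R[i] :=
  (limn (fun N : nat => \sum_(n < N) (complex.Re (f n%:Z) + complex.Re (f (- (n.+1)%:Z)))))%:C +
  'i * (limn (fun N : nat => \sum_(n < N) (complex.Im (f n%:Z) + complex.Im (f (- (n.+1)%:Z)))))%:C.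

(** Fourier symbols of the Hilbert transform: -i sgn(xi) *)
Definition hsymR (xi : R) : R[i] := - 'i * (Num.sg xi)%:C.
Definition hsymS (k : int) : R[i] := - 'i * ((Num.sg k)%:~R : R)%:C.

(** An element of B_0(R) is represented by its Fourier transform
    W0 in L^1(R); the function itself is
    x |-> \int W0(xi) e^{i x xi} dxi  (so that the Fourier transform of a
    product is the convolution of the Fourier transforms). *)
Definition finvR (W0 : R -> R[i]) (x : R) : R[i] :=
  cint setT (fun xi => W0 xi * cexpi (x * xi)).

Definition inB0R (W0 : R -> R[i]) : Prop := cintegrable setT W0.

Definition normB0R (W0 : R -> R[i]) : \bar R :=
  (\int[@lebesgue_measure R]_xi (cmod (W0 xi))%:E)%E.

(** space-time function, represented by W xi t = hat omega(xi, t) *)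
Definition supTR (W : R -> R -> R[i]) (xi : R) : \bar R :=
  ereal_sup [set (cmod (W xi t))%:E | t in `[0, +oo[%classic].

Definition inBB0R (W : R -> R -> R[i]) : Prop :=
  (forall t : R, 0 <= t -> cintegrable setT (fun xi => W xi t)) /\
  measurable_fun [set: R] (supTR W) /\
  (\int[@lebesgue_measure R]_xi supTR W xi < +oo)%E.

Definition omegaR (W : R -> R -> R[i]) (x t : R) : R[i] :=
  finvR (fun xi => W xi t) x.
Definition HomegaR (W : R -> R -> R[i]) (x t : R) : R[i] :=
  finvR (fun xi => hsymR xi * W xi t) x.

Definition mildR (nu : R) (W0 : R -> R[i]) (W : R -> R -> R[i]) : Prop :=
  forall t : R, 0 <= t -> forall x : R,
    let F := fun s : R =>
      (expR (- nu * (t - s)))%:C * (omegaR W x s * HomegaR W x s) in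
    cintegrable `[0, t]%classic F /\
    omegaR W x t = (expR (- nu * t))%:C * finvR W0 x + cint `[0, t]%classic F.

(** An element of B_0(S) is represented by its Fourier coefficients
    W0 : int -> C; the function is x |-> sum_k W0 k e^{i k x}. *)
Definition finvS (W0 : int -> R[i]) (x : R) : R[i] :=
  zsum (fun k => W0 k * cexpi (k%:~R * x)).

Definition normB0S (W0 : int -> R[i]) : \bar R :=
  (\esum_(k in [set: int]) (cmod (W0 k))%:E)%E.

Definition supTS (W : int -> R -> R[i]) (k : int) : \bar R :=
  ereal_sup [set (cmod (W k t))%:E | t in `[0, +oo[%classic].

Definition inBB0S (W : int -> R -> R[i]) : Prop :=
  (\esum_(k in [set: int]) supTS W k < +oo)%E.

Definition omegaS (W : int -> R -> R[i]) (x t : R) : R[i] :=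
  finvS (fun k => W k t) x.
Definition HomegaS (W : int -> R -> R[i]) (x t : R) : R[i] :=
  finvS (fun k => hsymS k * W k t) x.

Definition mildS (nu : R) (W0 : int -> R[i]) (W : int -> R -> R[i]) : Prop :=
  forall t : R, 0 <= t -> forall x : R,
    let F := fun s : R =>
      (expR (- nu * (t - s)))%:C * (omegaS W x s * HomegaS W x s) in
    cintegrable `[0, t]%classic F /\
    omegaS W x t = (expR (- nu * t))%:C * finvS W0 x + cint `[0, t]%classic F.

End Defs.

(* Main.v *)
Require Import Defs.
From HB Require Import structures.
From mathcomp Require Import all_boot all_order all_algebra.
From mathcomp Require Import all_classical all_reals all_analysis.
From mathcomp Require Import measurable_realfun complex.
From mathcomp Require Import ring lra.
Import Order.TTheory GRing.Theory Num.Theory.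
Import numFieldNormedType.Exports.

Set Implicit Arguments.
Unset Strict Implicit.
Unset Printing Implicit Defensive.

Local Open Scope classical_set_scope.
Local Open Scope ring_scope.
Local Open Scope complex_scope.

(* With [tau = (1 - exp (- nu t)) / nu] and [omega = exp (- nu t) theta(tau)] the
   equation becomes [theta' = theta (H theta)], which is solved by the power
   series [theta = sum_n a_n tau^n] with
     [(n + 1) a_(n+1) = sum_(j <= n) a_j (H a_(n-j))].
   Since H is a contraction of the Wiener algebra, [|a_n| <= b^(n+1)] where [b]
   bounds the norm of the datum, and [tau < 1 / nu]; hence the series converges
   absolutely, uniformly in time, as soon as [b < nu].  On the Fourier side
   products are convolutions, and the argument only uses an L^1 algebra over a
   group with a translation invariant sigma-finite measure, so that the line and
   the circle are two instances of one statement. *)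

(** * Power series with geometrically bounded coefficients *)

(** The mild equation is checked at each point [x] separately. There the function is the pairing of
    its Fourier side with a character, and characters turn convolutions into products of numbers. So
    for fixed [x] the recurrence becomes scalar, and the mild equation is the fundamental theorem of
    calculus for one scalar power series in [tau].

    The obstacle is on the Fourier side: the space-time norm takes a supremum over uncountably many
    times inside the integral over frequencies, whereas the coefficients are controlled only in
    norm. Summing [cl1 (a n z) / nu ^ n] yields one integrable majorant valid for all times. On the
    null set where it is infinite the coefficients are replaced by zero, which makes the series
    continuous in time at every frequency and its supremum measurable.

    As for the threshold [nu / 4]: passing from the modulus to [cl1] costs a factor 2, which gives
    [b = nu / 2]. The strict inequality [b < nu] is what integrability of the majorant and termwise
    differentiation rely on. *)

Section GeometricBounds.
Variable R : realType.
Implicit Types (c u v : nat -> R) (q r x : R).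

Definition geo_bounded r c := exists M : R, forall n, `|c n| <= M * r ^+ n.

Lemma geo_bounded_ge0 r c : geo_bounded r c ->
  exists2 M : R, 0 <= M & forall n, `|c n| <= M * r ^+ n.
Proof.
move=> [M cM]; exists M => //.
by have := cM 0%N; rewrite expr0 mulr1; apply: le_trans.
Qed.

Lemma le_geo_bounded r r' c : 0 <= r <= r' -> geo_bounded r c -> geo_bounded r' c.
Proof.
move=> /andP[r0 rr'] /geo_bounded_ge0[M M0 cM]; exists M => n.
by rewrite (le_trans (cM n))// ler_wpM2l// lerXn2r// nnegrE// (le_trans r0).
Qed.

Lemma geo_bounded_mulX r c x : geo_bounded r c ->
  geo_bounded (r * `|x|) (fun n => c n * x ^+ n).
Proof.
move=> [M cM]; exists M => n.
by rewrite normrM normrX exprMn mulrA ler_wpM2r.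
Qed.

(** The quotient [(1 - q ^ n) / (1 - q)] is a sum of [n] powers of [q], each at least [q ^ n]; so
    [n * q ^ n] is at most this quotient. *)
Lemma natr_mul_expr_bounded q : 0 < q < 1 ->
  forall n, n%:R * q ^+ n <= (1 - q)^-1.
Proof.
move=> /andP[q0 q1].
have h n : n%:R * q ^+ n * (1 - q) <= 1 - q ^+ n.
  elim: n => [|n IH]; first by rewrite mul0r mul0r expr0 subrr.
  have qn : 0 <= q ^+ n by rewrite exprn_ge0// ltW.
  have qn1 : q ^+ n <= 1 by rewrite exprn_ile1// ltW.
  rewrite -natr1 exprS.
  have : q * (n%:R * q ^+ n * (1 - q)) <= q * (1 - q ^+ n) by rewrite ler_pM2l.
  have : 0 <= (1 - q) * (1 - q * q ^+ n).
    by rewrite mulr_ge0//; [lra|rewrite -exprS subr_ge0 exprn_ile1// ltW].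
  set N := n%:R; set Q := q ^+ n; nra.
move=> n; rewrite -[leRHS]mul1r ler_pdivlMr; last by lra.
by rewrite (le_trans (h n))// gerBl exprn_ge0// ltW.
Qed.

(** A factor [n] costs an arbitrarily small increase of the ratio, since [(r / r') ^ n] absorbs it.
    Every termwise differentiation pays this price. *)
Lemma geo_bounded_natr r r' c : 0 < r < r' -> geo_bounded r c ->
  geo_bounded r' (fun n => n%:R * c n).
Proof.
move=> /andP[r0 rr'] /geo_bounded_ge0[M M0 cM].
have r'0 : 0 < r' by lra.
have q01 : 0 < r / r' < 1 by rewrite divr_gt0//= ltr_pdivrMr// mul1r.
exists (M * (1 - r / r')^-1) => n; rewrite normrM normr_nat.
have -> : M * (1 - r / r')^-1 * r' ^+ n = (1 - r / r')^-1 * (M * r' ^+ n) by ring.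
apply: (@le_trans _ _ (n%:R * (M * r ^+ n))); first by rewrite ler_wpM2l.
have -> : n%:R * (M * r ^+ n) = (n%:R * (r / r') ^+ n) * (M * r' ^+ n).
  by rewrite expr_div_n; field; rewrite expf_neq0// gt_eqF.
by rewrite ler_wpM2r ?mulr_ge0 ?exprn_ge0 ?(ltW r'0)// natr_mul_expr_bounded.
Qed.

Lemma geo_bounded_pseries_diffs r r' c : 0 < r < r' -> geo_bounded r c ->
  geo_bounded r' (pseries_diffs c).
Proof.
move=> rr' /(geo_bounded_natr rr')[M cM]; exists (M * r') => n.
by rewrite -mulrA -exprS; exact: cM.
Qed.

Lemma geo_bounded_cvg_norm q u : 0 <= q < 1 -> geo_bounded q u ->
  cvgn (series (fun n => `|u n|)).
Proof.
move=> /andP[q0 q1] /geo_bounded_ge0[M M0 uM].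
apply: (@series_le_cvg _ _ (geometric M q)) => //.
- by move=> n; rewrite /geometric/= mulr_ge0// exprn_ge0.
- by apply: is_cvg_geometric_series; rewrite ger0_norm.
Qed.

Lemma geo_bounded_cvg q u : 0 <= q < 1 -> geo_bounded q u -> cvgn (series u).
Proof. by move=> q1 uq; apply: normed_cvg; exact: geo_bounded_cvg_norm q1 uq. Qed.

Lemma geo_bounded_cvg_pseries r c x : 0 <= r -> r * `|x| < 1 ->
  geo_bounded r c -> cvgn (pseries c x).
Proof.
move=> r0 rx cr; apply: (@geo_bounded_cvg (r * `|x|)).
  by rewrite mulr_ge0.
exact: geo_bounded_mulX.
Qed.

(** Both sides sum [u j * v k] over the triangle [j + k < N], once along antidiagonals and once
    along rows. *)
Lemma sum_cauchy_productE u v N :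
  \sum_(n < N) \sum_(j < n.+1) u j * v (n - j)%N =
  \sum_(j < N) u j * \sum_(k < N - j) v k.
Proof.
elim: N => [|N IH]; first by rewrite !big_ord0.
rewrite big_ord_recr/= IH [RHS]big_ord_recr/= subSnn big_ord1 [X in _ + X = _]big_ord_recr/=.
rewrite subnn addrA; congr (_ + _); rewrite -big_split/=.
apply: eq_bigr => j _; rewrite subSn; last exact/ltnW/ltn_ord.
by rewrite big_ord_recr/= mulrDr.
Qed.

(** The product of the partial sums runs over the square [j, k < N], the Cauchy product over the
    triangle [j + k < N]. At most [N ^ 2] pairs are left over; each has [j + k >= N] and contributes
    at most [M * M' * q ^ N], so the difference tends to 0. *)
Lemma cvg_cauchy_product q u v : 0 < q < 1 -> geo_bounded q u -> geo_bounded q v ->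
  series (fun n => \sum_(j < n.+1) u j * v (n - j)%N) @ \oo -->
    limn (series u) * limn (series v).
Proof.
move=> q01 uq vq.
have q01' : 0 <= q < 1 by lra.
have cu := geo_bounded_cvg q01' uq; have cv := geo_bounded_cvg q01' vq.
have [M M0 uM] := geo_bounded_ge0 uq.
have [M' M'0 vM] := geo_bounded_ge0 vq.
have tail N j : (j <= N)%N ->
    `|\sum_(k < N) v k - \sum_(k < N - j) v k| <= j%:R * (M' * q ^+ (N - j)).
  move=> jN; rewrite -!(big_mkord xpredT v).
  rewrite (big_cat_nat (n := (N - j)%N))//= ?leq_subr// addrAC subrr add0r.
  apply: (le_trans (ler_norm_sum _ _ _)).
  have -> : j%:R * (M' * q ^+ (N - j)) = \sum_(N - j <= k < N) (M' * q ^+ (N - j)).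
    by rewrite sumr_const_nat subKn// mulr_natl.
  rewrite big_nat_cond [leRHS]big_nat_cond; apply: ler_sum => k /andP[/andP[jk kN] _].
  rewrite (le_trans (vM k))// ler_wpM2l// ler_wiXn2l//; lra.
set P := series _.
have PE N : series u N * series v N - P N =
    \sum_(j < N) u j * (\sum_(k < N) v k - \sum_(k < N - j) v k).
  rewrite /P /series/= !big_mkord sum_cauchy_productE mulr_suml -sumrB.
  by apply: eq_bigr => j _; rewrite mulrBr.
have Pbnd N : `|series u N * series v N - P N| <= M * M' * (N%:R * (N%:R * q ^+ N)).
  rewrite PE (le_trans (ler_norm_sum _ _ _))//.
  have -> : M * M' * (N%:R * (N%:R * q ^+ N)) =
      \sum_(j < N) (M * M' * (N%:R * q ^+ N)).
    by rewrite sumr_const card_ord -mulr_natl; ring.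
  apply: ler_sum => j _; rewrite normrM.
  have jN : (j <= N)%N by exact/ltnW/ltn_ord.
  have -> : M * M' * (N%:R * q ^+ N) = (M * q ^+ j) * (N%:R * (M' * q ^+ (N - j))).
    rewrite -{2}(subnKC jN) exprD; ring.
  apply: ler_pM => //; apply: (le_trans (tail _ _ jN)).
  by rewrite ler_wpM2r ?ler_nat// mulr_ge0// exprn_ge0//; lra.
(* Each of the two factors [n] is absorbed by a larger ratio, along
   [q < (1 + 3 q) / 4 < (1 + q) / 2 < 1]. *)
have [C C0 Cb] : exists2 C : R, 0 <= C & forall n, n%:R * (n%:R * q ^+ n) <= C * ((1 + q) / 2) ^+ n.
  have q1 : geo_bounded q (fun n => q ^+ n).
    by exists 1 => n; rewrite mul1r ger0_norm// exprn_ge0//; lra.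
  have q2 : 0 < q < (1 + 3 * q) / 4 by lra.
  have q3 : 0 < (1 + 3 * q) / 4 < (1 + q) / 2 by lra.
  have [C C0 H] := geo_bounded_ge0 (geo_bounded_natr q3 (geo_bounded_natr q2 q1)).
  by exists C => // n; apply: le_trans (H n); exact: ler_norm.
have D0 : series u \* series v - P @ \oo --> (0 : R).
  apply: (@squeeze_cvgr _ _ _ _ (fun n => - (geometric (M * M' * C) ((1 + q) / 2) n))
                                 (geometric (M * M' * C) ((1 + q) / 2))).
  - apply: nearW => n; rewrite -ler_norml/= (le_trans (Pbnd n))//.
    by rewrite -[leRHS]mulrA ler_wpM2l// mulr_ge0.
  - by rewrite -oppr0; apply: cvgN; apply: cvg_geometric; rewrite ger0_norm; lra.
  - by apply: cvg_geometric; rewrite ger0_norm; lra.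
have -> : P = (series u \* series v) - (series u \* series v - P).
  by apply/funext => n; rewrite !fctE opprB addrC subrK.
rewrite -[X in _ --> X]subr0; apply: cvgB => //; exact: cvgM.
Qed.

Lemma cvg_pseriesM r a b x : 0 <= r -> r * `|x| < 1 ->
  geo_bounded r a -> geo_bounded r b ->
  pseries (fun n => \sum_(j < n.+1) a j * b (n - j)%N) x @ \oo -->
  limn (pseries a x) * limn (pseries b x).
Proof.
move=> r0 rx ar br.
have rx0 : 0 <= r * `|x| by rewrite mulr_ge0.
(* At [x = 0] the natural ratio vanishes, while the product lemma wants a positive one; the midpoint
   with 1 is positive and still below 1. *)
have q1 : 0 <= r * `|x| <= (1 + r * `|x|) / 2 by lra.
have q01 : 0 < (1 + r * `|x|) / 2 < 1 by lra.
have := cvg_cauchy_product q01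
  (le_geo_bounded q1 (geo_bounded_mulX x ar))
  (le_geo_bounded q1 (geo_bounded_mulX x br)).
rewrite [X in series X @ _ --> _ -> _](_ : _ = fun n =>
  (\sum_(j < n.+1) a j * b (n - j)%N) * x ^+ n)//; apply/funext => n.
rewrite /= mulr_suml; apply: eq_bigr => j _.
have jn : (j <= n)%N by rewrite -ltnS.
have -> : x ^+ n = x ^+ j * x ^+ (n - j) by rewrite -exprD subnKC.
ring.
Qed.

Lemma lim_pseriesM r a b x : 0 <= r -> r * `|x| < 1 ->
  geo_bounded r a -> geo_bounded r b ->
  limn (pseries (fun n => \sum_(j < n.+1) a j * b (n - j)%N) x) =
  limn (pseries a x) * limn (pseries b x).
Proof. by move=> r0 rx ar br; apply: cvg_lim => //; exact: (cvg_pseriesM r0). Qed.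

Lemma is_derive_pseries r c x : 0 < r -> r * `|x| < 1 -> geo_bounded r c ->
  is_derive x 1 (fun y => limn (pseries c y)) (limn (pseries (pseries_diffs c) x)).
Proof.
move=> r0 rx cr.
have rx0 : 0 <= r * `|x| by rewrite mulr_ge0// ltW.
(* The point [d^-1] is the midpoint of [|x|] and [1 / r]. [pseries_snd_diffs] asks for convergence
   there of the series and of its first two derived series; [r1] and [r2] cut the interval from [r]
   to [d] into thirds and so make room for two increases of the ratio. *)
pose d := 2 * r / (1 + r * `|x|).
have rd : r < d by rewrite /d ltr_pdivlMr; [nra|lra].
have d0 : 0 < d by lra.
pose r1 := (2 * r + d) / 3; pose r2 := (r + 2 * d) / 3.
have h1 : 0 < r < r1 by rewrite /r1; lra.
have h2 : 0 < r1 < r2 by rewrite /r1 /r2; lra.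
have dK : d * `|d^-1| = 1 by rewrite ger0_norm ?invr_ge0 ?ltW// mulfV// gt_eqF.
have K0 : 0 < `|d^-1| by rewrite normr_gt0 invr_eq0 gt_eqF.
have lt1 s : s < d -> s * `|d^-1| < 1 by move=> sd; rewrite -dK ltr_pM2r.
apply: (@pseries_snd_diffs _ _ d^-1).
- by apply: (@geo_bounded_cvg_pseries r) => //; [lra|exact: lt1].
- apply: (@geo_bounded_cvg_pseries r1); [lra|apply: lt1; rewrite /r1; lra|].
  exact: geo_bounded_pseries_diffs cr.
- apply: (@geo_bounded_cvg_pseries r2); [lra|apply: lt1; rewrite /r2; lra|].
  exact: geo_bounded_pseries_diffs (geo_bounded_pseries_diffs h1 cr).
- rewrite -(ltr_pM2l d0) dK /d mulrAC ltr_pdivrMr; lra.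
Qed.

Lemma pseries_at0 c : limn (pseries c 0) = c 0%N.
Proof.
apply: cvg_lim => //; rewrite -(cvg_shiftn 1)/=.
rewrite (_ : (fun n => _) = cst (c 0%N)); first exact: cvg_cst.
apply/funext => n; rewrite /pseries/series/= addn1 big_nat_recl//= expr0 mulr1.
by rewrite big1 ?addr0// => i _; rewrite expr0n mulr0.
Qed.

End GeometricBounds.

(** * The change of time and the scalar mild equation *)

Section TimeChange.
Variables (R : realType) (nu : R).
Hypothesis nu0 : 0 < nu.

Definition tau (s : R) : R := (1 - expR (- nu * s)) / nu.

Lemma is_derive_tau (s : R) : is_derive s 1 tau (expR (- nu * s)).
Proof.
rewrite /tau.
have e : is_derive s 1 (fun x : R => expR (- nu * x)) (expR (- nu * s) * - nu).
  apply: (is_derive1_comp (f := @expR R) (g := fun x => - nu * x)).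
  by apply: (is_derive_eq (is_deriveZ (- nu) (is_derive_id s 1))); rewrite /GRing.scale/= mulr1.
have := is_deriveM (is_deriveB (is_derive_cst (1 : R) s 1) e) (is_derive_cst nu^-1 s 1).
move=> H; apply: is_derive_eq.
rewrite /GRing.scale/=; field; exact: lt0r_neq0.
Qed.

Lemma tau_itv (s : R) : 0 <= s -> 0 <= tau s < nu^-1.
Proof.
move=> s0; rewrite /tau; apply/andP; split.
  by rewrite divr_ge0 ?(ltW nu0)// subr_ge0 -expR0 ler_expR mulNr oppr_le0 mulr_ge0// ltW.
by rewrite -[ltRHS]mul1r ltr_pM2r ?invr_gt0// gtrBl expR_gt0.
Qed.

End TimeChange.

Section PowerSeriesInTime.
Variables (R : realType) (nu b : R).
Hypotheses (b0 : 0 < b) (bnu : b <= nu).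
Notation mu := (@lebesgue_measure R).
Implicit Types (c : nat -> R) (s t : R).

Let nu0 : 0 < nu. Proof. exact: lt_le_trans bnu. Qed.

(** Strictness comes from [tau nu s < 1 / nu], so the borderline ratio [b = nu] is covered; it is
    the one available at a fixed frequency. *)
Lemma tau_lt1 s : 0 <= s -> b * `|tau nu s| < 1.
Proof.
move=> /(tau_itv nu0)/andP[t0 t1]; rewrite ger0_norm//.
have -> : 1 = nu * nu^-1 by rewrite mulfV// gt_eqF.
by apply: (@le_lt_trans _ _ (nu * tau nu s)); [rewrite ler_wpM2r|rewrite ltr_pM2l].
Qed.

Lemma is_derive_pseries_tau c s : 0 <= s -> geo_bounded b c ->
  is_derive s 1 (fun s => limn (pseries c (tau nu s)))
    (limn (pseries (pseries_diffs c) (tau nu s)) * expR (- nu * s)).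
Proof.
move=> s0 cb.
apply: (is_derive1_comp (f := fun y => limn (pseries c y)) (g := tau nu)).
  by apply: (is_derive_pseries b0) => //; exact: tau_lt1.
exact: is_derive_tau.
Qed.

Lemma continuous_pseries_tau c s : 0 <= s -> geo_bounded b c ->
  {for s, continuous (fun s => limn (pseries c (tau nu s)))}.
Proof.
move=> s0 cb; apply: differentiable_continuous; apply/derivable1_diffP.
by have [] := is_derive_pseries_tau s0 cb.
Qed.

End PowerSeriesInTime.

Section MildIntegral.
Variables (R : realType) (nu b : R).
Hypotheses (b0 : 0 < b) (bnu : b < nu).
Notation mu := (@lebesgue_measure R).
Implicit Types (c : nat -> R) (s t : R).

(** The factor [expR (- nu * s)] is the derivative of [tau], so the integrand is the derivative in
    [s] of [expR (- nu * t) * limn (pseries c (tau nu s))]. *)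
Lemma integral_pseries_tau c t : 0 <= t -> geo_bounded b c ->
  let f s := expR (- nu * t) *
             (limn (pseries (pseries_diffs c) (tau nu s)) * expR (- nu * s)) in
  mu.-integrable `[0, t]%classic (EFin \o f) /\
  Rintegral mu `[0, t]%classic f =
    expR (- nu * t) * (limn (pseries c (tau nu t)) - c 0%N).
Proof.
move=> t0 cb f.
(* The derived coefficients need a ratio above [b]; the midpoint with [nu] is still admissible for
   continuity in time. *)
have [h1 h2] : 0 < b < (b + nu) / 2 /\ (b + nu) / 2 <= nu by move: b0 bnu; lra.
have dcb := geo_bounded_pseries_diffs h1 cb.
have fcont s : 0 <= s -> {for s, continuous f}.
  move=> s0; rewrite /prop_for /continuous_at /f.
  apply: cvgM; first exact: cvg_cst.
  apply: cvgM; first by apply: (@continuous_pseries_tau _ nu ((b + nu) / 2)) => //; lra.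
  apply: continuous_comp; last exact: continuous_expR.
  by apply: cvgM; [exact: cvg_cst|exact: cvg_id].
have fw : {within `[0, t], continuous f}.
  apply: continuous_in_subspaceT => s; rewrite inE/= in_itv/= => /andP[s0 _].
  exact: fcont.
have fi : mu.-integrable `[0, t]%classic (EFin \o f).
  by apply: continuous_compact_integrable => //; exact: segment_compact.
(* The fundamental theorem of calculus is applied on an interval of positive length; at [t = 0] both
   sides vanish. *)
split => //; move: t0; rewrite le_eqVlt => /predU1P[<-|t0].
  rewrite set_itv1 Rintegral_set1 /tau mulr0 expR0 subrr mul0r pseries_at0.
  by rewrite subrr mulr0.
pose F s := expR (- nu * t) * limn (pseries c (tau nu s)).
have Fd s : 0 <= s -> is_derive s 1 F (f s).
  move=> s0; have := is_derive_pseries_tau b0 (ltW bnu) s0 cb => H.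
  exact: (is_derive_eq (is_deriveZ (expR (- nu * t)) H)).
have Fc s : 0 <= s -> F x @[x --> s] --> F s.
  move=> s0; apply: differentiable_continuous; apply/derivable1_diffP.
  by have [] := Fd s s0.
have FO : derivable_oo_LRcontinuous F 0 t.
  split.
  - move=> s; rewrite in_itv/= => /andP[/ltW s0 _].
    by have [] := Fd s s0.
  - by apply: cvg_at_right_filter; exact: Fc.
  - by apply: cvg_at_left_filter; apply: Fc; exact: ltW.
rewrite /Rintegral (continuous_FTC2 t0 fw FO).
  by rewrite -EFinB/= /F [in tau nu 0]/tau mulr0 expR0 subrr mul0r pseries_at0 mulrBr.
move=> s; rewrite in_itv/= => /andP[/ltW s0 _].
by rewrite derive1E; apply: derive_val; exact: Fd.
Qed.

Definition cpseries (A : nat -> R[i]) (x : R) : R[i] :=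
  limn (pseries (fun n => complex.Re (A n)) x) +i*
  limn (pseries (fun n => complex.Im (A n)) x).

(** For the sums [p] of [A] and [q] of [B], the recurrence says [p' = p * q], the right side being a
    Cauchy product. Hence [F s] is [exp (- nu t)] times the derivative of [p (tau s)] in [s], and
    its integral is [exp (- nu t) * (p (tau t) - A 0)]. *)
Lemma mild_cpseries (A B : nat -> R[i]) t : 0 <= t ->
  geo_bounded b (fun n => complex.Re (A n)) -> geo_bounded b (fun n => complex.Im (A n)) ->
  geo_bounded b (fun n => complex.Re (B n)) -> geo_bounded b (fun n => complex.Im (B n)) ->
  (forall n, (n.+1%:R)%:C * A n.+1 = \sum_(j < n.+1) A j * B (n - j)%N) ->
  let F s := (expR (- nu * (t - s)))%:C *
    (((expR (- nu * s))%:C * cpseries A (tau nu s)) *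
     ((expR (- nu * s))%:C * cpseries B (tau nu s))) in
  cintegrable `[0, t]%classic F /\
  (expR (- nu * t))%:C * cpseries A (tau nu t) =
    (expR (- nu * t))%:C * A 0%N + cint `[0, t]%classic F.
Proof.
move=> t0 Ar Ai Br Bi AB F.
have ReE n : pseries_diffs (fun n => complex.Re (A n)) n =
   \sum_(j < n.+1) complex.Re (A j) * complex.Re (B (n - j)%N)
   - \sum_(j < n.+1) complex.Im (A j) * complex.Im (B (n - j)%N).
  have /(congr1 (@complex.Re R)) := AB n.
  rewrite raddf_sum/= /pseries_diffs; case: (A n.+1) => x y /=.
  rewrite mul0r subr0 => ->; rewrite -sumrB; apply: eq_bigr => j _.
  by case: (A j) => ? ?; case: (B _).
have ImE n : pseries_diffs (fun n => complex.Im (A n)) n =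
   \sum_(j < n.+1) complex.Re (A j) * complex.Im (B (n - j)%N)
   + \sum_(j < n.+1) complex.Im (A j) * complex.Re (B (n - j)%N).
  have /(congr1 (@complex.Im R)) := AB n.
  rewrite raddf_sum/= /pseries_diffs; case: (A n.+1) => x y /=.
  rewrite mul0r addr0 => ->; rewrite -big_split; apply: eq_bigr => j _.
  by case: (A j) => ? ?; case: (B _).
have Re_lim s : 0 <= s ->
    limn (pseries (pseries_diffs (fun n => complex.Re (A n))) (tau nu s)) =
    complex.Re (cpseries A (tau nu s) * cpseries B (tau nu s)).
  move=> s0; rewrite /cpseries/=; have st := tau_lt1 b0 (ltW bnu) s0; have b0' := ltW b0.
  rewrite -!(lim_pseriesM b0' st)// -limB; last 2 first.
    exact: cvgP (cvg_pseriesM b0' st Ar Br).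
    exact: cvgP (cvg_pseriesM b0' st Ai Bi).
  congr (limn _); apply/funext => n; rewrite /pseries/series/= !fctE -sumrB.
  by apply: eq_bigr => i _ /=; rewrite ReE mulrBl.
have Im_lim s : 0 <= s ->
    limn (pseries (pseries_diffs (fun n => complex.Im (A n))) (tau nu s)) =
    complex.Im (cpseries A (tau nu s) * cpseries B (tau nu s)).
  move=> s0; rewrite /cpseries/=; have st := tau_lt1 b0 (ltW bnu) s0; have b0' := ltW b0.
  rewrite -!(lim_pseriesM b0' st)// -limD; last 2 first.
    exact: cvgP (cvg_pseriesM b0' st Ar Bi).
    exact: cvgP (cvg_pseriesM b0' st Ai Br).
  congr (limn _); apply/funext => n; rewrite /pseries/series/= !fctE -big_split.
  by apply: eq_bigr => i _ /=; rewrite ImE mulrDl.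
(* Since [- nu (t - s) - 2 nu s = - nu t - nu s], the three exponentials reduce to a constant and
   the derivative of [tau]. *)
have FE s : F s = (expR (- nu * t))%:C * ((expR (- nu * s))%:C *
    (cpseries A (tau nu s) * cpseries B (tau nu s))).
  rewrite /F (_ : - nu * (t - s) = - nu * t + nu * s); last by ring.
  rewrite expRD (_ : nu * s = - (- nu * s)); last by ring.
  rewrite expRN; set e1 := expR _; set e2 := expR _.
  have -> : (e1 / e2)%:C = e1%:C * (e2%:C)^-1 :> R[i] by rewrite rmorphM/= fmorphV.
  have : e2%:C != 0 :> R[i] by rewrite fmorph_eq0 gt_eqF// expR_gt0.
  move: e1%:C e2%:C => x y y0; by field.
have [rI rE] := integral_pseries_tau t0 Ar.
have [iI iE] := integral_pseries_tau t0 Ai.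
have ReF s : 0 <= s -> complex.Re (F s) = expR (- nu * t) *
    (limn (pseries (pseries_diffs (fun n => complex.Re (A n))) (tau nu s)) * expR (- nu * s)).
  move=> s0; rewrite FE Re_lim//; case: (_ * cpseries B _) => x y /=; ring.
have ImF s : 0 <= s -> complex.Im (F s) = expR (- nu * t) *
    (limn (pseries (pseries_diffs (fun n => complex.Im (A n))) (tau nu s)) * expR (- nu * s)).
  move=> s0; rewrite FE Im_lim//; case: (_ * cpseries B _) => x y /=; ring.
split.
  split; [apply: eq_integrable rI => // s|apply: eq_integrable iI => // s];
    rewrite inE/= in_itv/= => /andP[s0 _]; congr (_%:E).
  - exact/esym/ReF.
  - exact/esym/ImF.
have rE' : Rintegral mu `[0, t]%classic (fun s => complex.Re (F s)) =
    expR (- nu * t) * (limn (pseries (fun n => complex.Re (A n)) (tau nu t)) - complex.Re (A 0%N)).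
  rewrite -rE; apply: eq_Rintegral => s.
  by rewrite inE/= in_itv/= => /andP[s0 _]; exact: ReF.
have iE' : Rintegral mu `[0, t]%classic (fun s => complex.Im (F s)) =
    expR (- nu * t) * (limn (pseries (fun n => complex.Im (A n)) (tau nu t)) - complex.Im (A 0%N)).
  rewrite -iE; apply: eq_Rintegral => s.
  by rewrite inE/= in_itv/= => /andP[s0 _]; exact: ImF.
rewrite /cint rE' iE' /cpseries; case: (A 0%N) => x y.
apply/eqP; rewrite eq_complex/=; apply/andP; split; apply/eqP; ring.
Qed.

End MildIntegral.

(** * Integration of complex functions *)

Section ComplexL1.
Context {R : realType}.
Implicit Types z w : R[i].

(* The l^1 norm on C is submultiplicative and integrates componentwise; the
   factor 2 lost against [cmod] is absorbed by the smallness assumption. *)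
Definition cl1 z : R := `|complex.Re z| + `|complex.Im z|.

Lemma cl1_ge0 z : 0 <= cl1 z. Proof. by rewrite addr_ge0. Qed.

Lemma cl1D z w : cl1 (z + w) <= cl1 z + cl1 w.
Proof.
case: z w => [a b] [c d]; rewrite /cl1/=.
have := ler_normD a c; have := ler_normD b d; lra.
Qed.

Lemma cl1_sum (I : Type) (r : seq I) (P : pred I) (F : I -> R[i]) :
  cl1 (\sum_(i <- r | P i) F i) <= \sum_(i <- r | P i) cl1 (F i).
Proof.
elim/big_ind2 : _ => //; first by rewrite /cl1/= normr0 addr0.
by move=> x y z w zx wy; rewrite (le_trans (cl1D _ _))// lerD.
Qed.

Lemma cl1M z w : cl1 (z * w) <= cl1 z * cl1 w.
Proof.
case: z w => [a b] [c d]; rewrite /cl1/=.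
have := ler_normB (a * c) (b * d); have := ler_normD (a * d) (b * c).
rewrite !normrM; lra.
Qed.

Lemma cl1_real (x : R) z : cl1 (x%:C * z) = `|x| * cl1 z.
Proof. by case: z => a b; rewrite /cl1/= !mul0r subr0 addr0 !normrM mulrDr. Qed.

Lemma cmod_le_cl1 z : cmod z <= cl1 z.
Proof.
case: z => a b; rewrite /cmod/cl1/=.
rewrite -[leRHS]ger0_norm ?addr_ge0// -sqrtr_sqr ler_sqrt ?sqr_ge0//.
rewrite -(real_normK (num_real a)) -(real_normK (num_real b)).
have := mulr_ge0 (normr_ge0 a) (normr_ge0 b); nra.
Qed.

Lemma cl1_le_cmod z : cl1 z <= 2 * cmod z.
Proof.
case: z => a b; rewrite /cmod/cl1/=.
have h x y : `|x| <= Num.sqrt (x ^+ 2 + y ^+ 2) :> R.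
  by rewrite -sqrtr_sqr ler_sqrt ?addr_ge0 ?sqr_ge0// lerDl sqr_ge0.
by have := h a b; have := h b a; rewrite (addrC (b ^+ 2)); lra.
Qed.

Lemma complexE (x y : R) : x%:C + 'i * y%:C = x +i* y.
Proof. by apply/eqP; rewrite eq_complex/=; apply/andP; split; apply/eqP; ring. Qed.

End ComplexL1.

Section ComplexIntegral.
Context {d : measure_display} {T : measurableType d} {R : realType}.
Variable mu : {measure set T -> \bar R}.
Implicit Types f g k : T -> R[i].

Definition cmeasurable f :=
  measurable_fun setT (fun x => complex.Re (f x)) /\
  measurable_fun setT (fun x => complex.Im (f x)).

Definition l1_integrable f :=
  mu.-integrable setT (EFin \o (fun x => complex.Re (f x))) /\
  mu.-integrable setT (EFin \o (fun x => complex.Im (f x))).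

Definition cintegral f : R[i] :=
  (\int[mu]_x complex.Re (f x))%R +i* (\int[mu]_x complex.Im (f x))%R.

Definition l1_norm f : \bar R := (\int[mu]_x (cl1 (f x))%:E)%E.

Lemma l1_norm_ge0 f : (0 <= l1_norm f)%E.
Proof. by apply: integral_ge0 => x _; rewrite lee_fin cl1_ge0. Qed.

Lemma measurable_cl1 f : cmeasurable f -> measurable_fun setT (fun x => cl1 (f x)).
Proof.
by move=> [fr fi]; apply: measurable_funD; apply: measurableT_comp.
Qed.

Lemma cmeasurableM f g : cmeasurable f -> cmeasurable g ->
  cmeasurable (fun x => f x * g x).
Proof.
move=> [fr fi] [gr gi]; split.
  rewrite (_ : (fun x => _) = (fun x => complex.Re (f x) * complex.Re (g x)
    - complex.Im (f x) * complex.Im (g x))).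
    by apply: measurable_funB; apply: measurable_funM.
  by apply/funext => x; case: (f x) => ? ?; case: (g x).
rewrite (_ : (fun x => _) = (fun x => complex.Re (f x) * complex.Im (g x)
  + complex.Im (f x) * complex.Re (g x))).
  by apply: measurable_funD; apply: measurable_funM.
by apply/funext => x; case: (f x) => ? ?; case: (g x).
Qed.

Lemma cmeasurableD f g : cmeasurable f -> cmeasurable g ->
  cmeasurable (fun x => f x + g x).
Proof.
move=> [fr fi] [gr gi]; split.
  rewrite (_ : (fun x => _) = (fun x => complex.Re (f x) + complex.Re (g x))).
    exact: measurable_funD.
  by apply/funext => x; case: (f x) => ? ?; case: (g x).
rewrite (_ : (fun x => _) = (fun x => complex.Im (f x) + complex.Im (g x))).
  exact: measurable_funD.
by apply/funext => x; case: (f x) => ? ?; case: (g x).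
Qed.

Lemma cmeasurable_cst (c : R[i]) : cmeasurable (fun=> c).
Proof. by split; exact: measurable_cst. Qed.

Lemma l1_integrableP f :
  l1_integrable f <-> cmeasurable f /\ (l1_norm f < +oo)%E.
Proof.
split=> [[fr fi]|[[mr mi] foo]].
  have mf : cmeasurable f by split; apply/measurable_EFinP;
    [exact: (measurable_int mu fr)|exact: (measurable_int mu fi)].
  split=> //; rewrite /l1_norm.
  have := integrableD measurableT (integrable_abse fr) (integrable_abse fi).
  move=> /integrableP[_]; apply: le_lt_trans; apply: ge0_le_integral => //.
  - by move=> x _; rewrite lee_fin cl1_ge0.
  - by apply/measurable_EFinP; exact: measurable_cl1.
  - apply: measurableT_comp => //; apply: emeasurable_funD; apply: measurableT_comp => //.
      exact: (measurable_int mu fr).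
    exact: (measurable_int mu fi).
  - by move=> x _ /=; rewrite lee_fin ler_norm.
have dom (p : R[i] -> R) : (forall z, `|p z| <= cl1 z) ->
    measurable_fun setT (fun x => p (f x)) ->
    mu.-integrable setT (EFin \o (fun x => p (f x))).
  move=> ple mp; apply/integrableP; split; first exact/measurable_EFinP.
  apply: le_lt_trans foo; apply: ge0_le_integral => //.
  - by apply: measurableT_comp => //; exact/measurable_EFinP.
  - by apply/measurable_EFinP; exact: measurable_cl1.
  - by move=> x _ /=; rewrite lee_fin.
split; apply: dom => // z; rewrite /cl1; [rewrite lerDl|rewrite lerDr]; exact: normr_ge0.
Qed.

Lemma le_l1_norm f g : cmeasurable f -> cmeasurable g ->
  (forall x, cl1 (f x) <= cl1 (g x)) -> (l1_norm f <= l1_norm g)%E.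
Proof.
move=> mf mg fg; apply: ge0_le_integral => //.
- by move=> x _; rewrite lee_fin cl1_ge0.
- by apply/measurable_EFinP; exact: measurable_cl1.
- by apply/measurable_EFinP; exact: measurable_cl1.
- by move=> x _; rewrite lee_fin.
Qed.

Lemma l1_norm_real (a : R) f : cmeasurable f ->
  l1_norm (fun x => a%:C * f x) = (`|a|%:E * l1_norm f)%E.
Proof.
move=> mf; rewrite /l1_norm; under eq_integral do rewrite cl1_real EFinM.
rewrite ge0_integralZl//.
- by apply/measurable_EFinP; exact: measurable_cl1.
- by move=> x _; rewrite lee_fin cl1_ge0.
Qed.

Lemma l1_normD f g : cmeasurable f -> cmeasurable g ->
  (l1_norm (fun x => f x + g x)%R <= l1_norm f + l1_norm g)%E.
Proof.
move=> mf mg; rewrite /l1_norm -ge0_integralD//.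
- apply: ge0_le_integral => //.
  + by move=> x _; rewrite lee_fin cl1_ge0.
  + by apply/measurable_EFinP; apply: measurable_cl1; exact: cmeasurableD.
  + by apply: emeasurable_funD; apply/measurable_EFinP; exact: measurable_cl1.
  + by move=> x _; rewrite -EFinD lee_fin cl1D.
- by move=> x _; rewrite lee_fin cl1_ge0.
- by apply/measurable_EFinP; exact: measurable_cl1.
- by move=> x _; rewrite lee_fin cl1_ge0.
- by apply/measurable_EFinP; exact: measurable_cl1.
Qed.

Lemma l1_integrableD f g : l1_integrable f -> l1_integrable g ->
  l1_integrable (fun x => f x + g x).
Proof.
move=> /l1_integrableP[mf nf] /l1_integrableP[mg ng]; apply/l1_integrableP; split.
  exact: cmeasurableD.
by apply: le_lt_trans (l1_normD mf mg) _; exact: lte_add_pinfty.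
Qed.

Lemma l1_integrableMb f k (C : R) : l1_integrable f -> cmeasurable k ->
  (forall x, cl1 (k x) <= C) -> l1_integrable (fun x => f x * k x).
Proof.
move=> /l1_integrableP[mf nf] mk kC; have mfk := cmeasurableM mf mk.
apply/l1_integrableP; split=> //.
have : (l1_norm (fun x => C%:C * f x)%R < +oo)%E.
  by rewrite l1_norm_real// lte_mul_pinfty// lee_fin.
apply: le_lt_trans; apply: le_l1_norm => //.
  by apply: cmeasurableM => //; exact: cmeasurable_cst.
move=> x; rewrite cl1_real (le_trans (cl1M _ _))// mulrC ler_wpM2r ?cl1_ge0//.
by rewrite (le_trans (kC x))// ler_norm.
Qed.

Lemma l1_integrableZ (c : R[i]) f : l1_integrable f ->
  l1_integrable (fun x => c * f x).
Proof.
move=> fi; rewrite (_ : (fun x => _) = (fun x => f x * c)).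
  exact: (l1_integrableMb fi (cmeasurable_cst c) (fun=> lexx _)).
by apply/funext => x; rewrite mulrC.
Qed.

Lemma cintegralD f g : l1_integrable f -> l1_integrable g ->
  cintegral (fun x => f x + g x) = cintegral f + cintegral g.
Proof.
move=> [fr fi] [gr gi]; apply/eqP; rewrite eq_complex/=.
apply/andP; split; apply/eqP; rewrite -RintegralD//; apply: eq_Rintegral => x _;
  by case: (f x) => ? ?; case: (g x).
Qed.

Lemma cintegralZ (c : R[i]) f : l1_integrable f ->
  cintegral (fun x => c * f x) = c * cintegral f.
Proof.
case: c => a b [fr fi]; apply/eqP; rewrite eq_complex/=.
have Zi (p : T -> R) (r : R) : mu.-integrable setT (EFin \o p) ->
    mu.-integrable setT (EFin \o (fun x => r * p x)).
  by move=> pi; have := integrableZl measurableT r pi.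
apply/andP; split; apply/eqP; rewrite -!RintegralZl//.
  rewrite -RintegralB//; [|exact: Zi|exact: Zi].
  by apply: eq_Rintegral => x _; case: (f x).
rewrite -RintegralD//; [|exact: Zi|exact: Zi].
by apply: eq_Rintegral => x _; case: (f x).
Qed.

Lemma l1_norm_sum n (t : 'I_n -> T -> R[i]) :
  (forall j, l1_integrable (t j)) ->
  l1_integrable (fun x => \sum_(j < n) t j x) /\
  (l1_norm (fun x => \sum_(j < n) t j x)%R <= \sum_(j < n) l1_norm (t j))%E.
Proof.
elim: n t => [t _|n IH t ti].
  have z : (fun x => \sum_(j < 0) t j x) = (fun=> 0) by apply/funext => x; rewrite big_ord0.
  have E : l1_norm (fun=> 0) = 0%E.
    by rewrite /l1_norm /cl1/= normr0 addr0 integral0.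
  rewrite z big_ord0 E; split=> //; apply/l1_integrableP.
  by rewrite E; split=> //; exact: cmeasurable_cst.
have [si sn] := IH (fun j => t (widen_ord (leqnSn n) j)) (fun j => ti _).
have -> : (fun x => \sum_(j < n.+1) t j x) = (fun x =>
    \sum_(j < n) t (widen_ord (leqnSn n) j) x + t ord_max x).
  by apply/funext => x; rewrite big_ord_recr.
have tm := ti ord_max; split; first exact: l1_integrableD.
have [ms _] := (l1_integrableP _).1 si; have [mt _] := (l1_integrableP _).1 tm.
by rewrite big_ord_recr/=; apply: le_trans (l1_normD ms mt) _; rewrite leeD2r.
Qed.

Lemma cintegral_sum n (t : 'I_n -> T -> R[i]) : (forall j, l1_integrable (t j)) ->
  cintegral (fun x => \sum_(j < n) t j x) = \sum_(j < n) cintegral (t j).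
Proof.
elim: n t => [t _|n IH t ti].
  rewrite big_ord0 (_ : (fun x => _) = (fun=> 0)); last first.
    by apply/funext => x; rewrite big_ord0.
  by rewrite /cintegral/= /Rintegral integral0.
rewrite big_ord_recr/= -IH//.
rewrite -cintegralD//; last exact: (l1_norm_sum _).1.
by congr cintegral; apply/funext => x; rewrite big_ord_recr.
Qed.

Lemma eq_cintegral f g : f =1 g -> cintegral f = cintegral g.
Proof. by move=> fg; congr cintegral; exact/funext. Qed.

Lemma ae_eq_cintegral f g : cmeasurable f -> cmeasurable g ->
  {ae mu, forall x, f x = g x} -> cintegral f = cintegral g.
Proof.
move=> [fr fi] [gr gi] fg; rewrite /cintegral /Rintegral.
congr (fine _ +i* fine _); apply: ae_eq_integral => //.
- exact/measurable_EFinP.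
- exact/measurable_EFinP.
- by apply: filterS fg => x /= ->.
- exact/measurable_EFinP.
- exact/measurable_EFinP.
- by apply: filterS fg => x /= ->.
Qed.

Lemma cl1_cintegral f : l1_integrable f -> ((cl1 (cintegral f))%:E <= l1_norm f)%E.
Proof.
move=> [fr fi]; rewrite /l1_norm /cl1/=.
under eq_integral do rewrite EFinD.
rewrite ge0_integralD//; last 2 first.
- by have /measurable_EFinP h := measurable_int mu fr; apply/measurable_EFinP; exact: measurableT_comp.
- by have /measurable_EFinP h := measurable_int mu fi; apply/measurable_EFinP; exact: measurableT_comp.
rewrite EFinD; apply: leeD; rewrite EFin_normr_Rintegral//;
  apply: le_abse_integral => //.
- exact: (measurable_int mu fr).
- exact: (measurable_int mu fi).
Qed.

End ComplexIntegral.

(** * Convolution on a measured group *)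

Section ComplexFubini.
Context {d : measure_display} {G : measurableType d} {R : realType}.
Variable mu : {sigma_finite_measure set G -> \bar R}.

(** An integrable function is finite almost everywhere, so [fine] alters it only on a null set. *)
Lemma fine_integral (f : G -> \bar R) : mu.-integrable setT f ->
  mu.-integrable setT (EFin \o (fine \o f)) /\
  (\int[mu]_x (fine (f x))%:E = \int[mu]_x f x)%E.
Proof.
move=> fi; have mf := measurable_int mu fi.
have mff : measurable_fun setT (EFin \o (fine \o f)).
  by apply/measurable_EFinP; apply: measurableT_comp => //; exact: measurable_fine.
split.
  apply: le_integrable fi => // x _ /=.
  by case: (f x) => //= *; rewrite ?normr0 ?leey.
apply: ae_eq_integral => //.
by apply: filterS (integrable_ae measurableT fi) => x /= fx _; rewrite fineK// fx.
Qed.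

Lemma Rintegral_fubini (h : G * G -> R) :
  (mu \x mu)%E.-integrable setT (EFin \o h) ->
  [/\ {ae mu, forall z, mu.-integrable setT (EFin \o (fun y => h (z, y)))},
     mu.-integrable setT (EFin \o (fun z => \int[mu]_y h (z, y))%R) &
     (\int[mu]_z \int[mu]_y h (z, y) = \int[mu]_y \int[mu]_z h (z, y))%R ].
Proof.
move=> ih.
have [i1 e1] := fine_integral (integrable_fubini_F ih).
split => //; first exact: (ae_integrable1 ih).
have i2 : mu.-integrable setT (fubini_G mu (EFin \o h)).
  apply/integrableP; split; first exact: (measurable_fubini_G ih).
  apply: le_lt_trans ((integrable21ltyP _ _ (measurable_int _ ih)).1 ih).
  apply: ge0_le_integral => //.
  - by apply: measurableT_comp => //; exact: (measurable_fubini_G ih).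
  - apply: (measurable_fun_fubini_tonelli_G (abse \o (EFin \o h))) => //.
      by apply: measurableT_comp => //; exact: measurable_int ih.
    by move=> x; exact: abse_ge0.
  - move=> y _; apply: le_abse_integral => //.
    apply: measurableT_comp; last exact: measurable_pair2.
    exact: measurable_int ih.
have [_ e2] := fine_integral i2.
have := Fubini ih; rewrite /Rintegral => E.
by congr fine; rewrite e1 e2; exact: E.
Qed.

Lemma cintegral_fubini (H : G * G -> R[i]) : l1_integrable (mu \x mu)%E H ->
  [/\ {ae mu, forall z, l1_integrable mu (fun y => H (z, y))},
     l1_integrable mu (fun z => cintegral mu (fun y => H (z, y))) &
     cintegral mu (fun z => cintegral mu (fun y => H (z, y))) =
     cintegral mu (fun y => cintegral mu (fun z => H (z, y)))].
Proof.
move=> [Hr Hi].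
have [ar ir er] := Rintegral_fubini Hr; have [ai ii ei] := Rintegral_fubini Hi.
split.
- by apply: filterS2 ar ai => z.
- by split.
- by rewrite /cintegral/= er ei.
Qed.

End ComplexFubini.

Section Convolution.
Context {d : measure_display} {G : measurableType d} {R : realType}.
Variable mu : {sigma_finite_measure set G -> \bar R}.
(* [sb] is the group subtraction; translation invariance and the character
   identity [e z = e (sb z y) * e y] are all that is used of the group. *)
Variable sb : G -> G -> G.
Hypothesis msb : measurable_fun setT (fun p : G * G => sb p.1 p.2).
Hypothesis sb_inv : forall (f : G -> \bar R) y, measurable_fun setT f ->
  (forall x, 0 <= f x)%E -> (\int[mu]_z f (sb z y) = \int[mu]_z f z)%E.
Implicit Types f g e : G -> R[i].

(** For integrable [f] and [g] the integrand is known to be integrable only for almost every [z];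
    elsewhere the value is an artefact of [fine], invisible to norms and integrals. *)
Definition conv f g (z : G) : R[i] := cintegral mu (fun y => f (sb z y) * g y).

Let K f g (p : G * G) : R[i] := f (sb p.1 p.2) * g p.2.

Let mK f g : cmeasurable f -> cmeasurable g -> cmeasurable (K f g).
Proof.
move=> [fr fi] [gr gi]; apply: cmeasurableM; split.
- exact: (measurableT_comp fr msb).
- exact: (measurableT_comp fi msb).
- exact: (measurableT_comp gr measurable_snd).
- exact: (measurableT_comp gi measurable_snd).
Qed.

(** Tonelli puts the integral over [z] inside. There [cl1M] bounds it by [cl1 (g y)] times the norm
    of a translate of [f], which by invariance is the same for all [y]. *)
Let K_norm f g : cmeasurable f -> cmeasurable g -> (l1_norm mu f < +oo)%E ->
  (\int[mu]_z \int[mu]_y (cl1 (K f g (z, y)))%:E <= l1_norm mu f * l1_norm mu g)%E.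
Proof.
move=> mf mg nf.
rewrite (fubini_tonelli (fun p => (cl1 (K f g p))%:E)); last 2 first.
- by apply/measurable_EFinP; apply: measurable_cl1; exact: mK.
- by move=> x; rewrite lee_fin cl1_ge0.
have m1 : measurable_fun setT (fun x => (cl1 (f x))%:E).
  by apply/measurable_EFinP; exact: measurable_cl1.
have m2 : measurable_fun setT (fun x => (cl1 (g x))%:E).
  by apply/measurable_EFinP; exact: measurable_cl1.
have -> : (l1_norm mu f * l1_norm mu g =
    \int[mu]_y ((fine (l1_norm mu f))%:E * (cl1 (g y))%:E))%E.
  rewrite ge0_integralZl//; last 2 first.
  - by move=> y _; rewrite lee_fin cl1_ge0.
  - by rewrite lee_fin fine_ge0// l1_norm_ge0.
  by rewrite fineK// ge0_fin_numE// l1_norm_ge0.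
apply: ge0_le_integral => //.
- by move=> y _; apply: integral_ge0 => z _; rewrite lee_fin cl1_ge0.
- apply: (measurable_fun_fubini_tonelli_G (fun p => (cl1 (K f g p))%:E)).
    by apply/measurable_EFinP; apply: measurable_cl1; exact: mK.
  by move=> x; rewrite lee_fin cl1_ge0.
- by apply: emeasurable_funM.
move=> y _.
have my : measurable_fun setT (fun z => sb z y).
  exact: (measurableT_comp msb (measurable_pair2 y)).
rewrite fineK; last by rewrite ge0_fin_numE// l1_norm_ge0.
rewrite /l1_norm -(@sb_inv _ y m1); last by move=> x; rewrite lee_fin cl1_ge0.
rewrite muleC -ge0_integralZl//; last 3 first.
- exact: (measurableT_comp m1 my).
- by move=> z _; rewrite lee_fin cl1_ge0.
- by rewrite lee_fin cl1_ge0.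
apply: ge0_le_integral => //.
- by move=> z _; rewrite lee_fin cl1_ge0.
- have /measurable_EFinP := measurable_cl1 (mK mf mg).
  by move=> h; exact: (measurableT_comp h (measurable_pair2 y)).
- by apply: emeasurable_funM => //; exact: (measurableT_comp m1 my).
- by move=> z _; rewrite -EFinM lee_fin mulrC cl1M.
Qed.

Lemma conv_kernel_integrable f g : l1_integrable mu f -> l1_integrable mu g ->
  l1_integrable (mu \x mu)%E (fun p => f (sb p.1 p.2) * g p.2).
Proof.
move=> /l1_integrableP[mf nf] /l1_integrableP[mg ng]; apply/l1_integrableP.
split; first exact: mK.
rewrite /l1_norm fubini_tonelli1/=; last 2 first.
- by apply/measurable_EFinP; apply: measurable_cl1; exact: mK.
- by move=> x; rewrite lee_fin cl1_ge0.
apply: le_lt_trans (K_norm mf mg nf) _.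
by rewrite lte_mul_pinfty// ?l1_norm_ge0// ge0_fin_numE// l1_norm_ge0.
Qed.

Lemma conv_integrable f g : l1_integrable mu f -> l1_integrable mu g ->
  l1_integrable mu (conv f g).
Proof. by move=> fi gi; have [] := cintegral_fubini (conv_kernel_integrable fi gi). Qed.

Lemma conv_norm f g : l1_integrable mu f -> l1_integrable mu g ->
  (l1_norm mu (conv f g) <= l1_norm mu f * l1_norm mu g)%E.
Proof.
move=> fi gi; have [mf nf] := (l1_integrableP mu f).1 fi.
have [mg ng] := (l1_integrableP mu g).1 gi.
apply: le_trans (K_norm mf mg nf).
have [ae ii _] := cintegral_fubini (conv_kernel_integrable fi gi).
have [mc nc] := (l1_integrableP mu _).1 ii.
(* Bounding an integral by the integral of the norm needs an integrable kernel, hence holds for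
   almost every [z] only. *)
apply: ae_ge0_le_integral => //.
- by move=> x _; rewrite lee_fin cl1_ge0.
- by apply/measurable_EFinP; exact: measurable_cl1.
- by move=> z _; apply: integral_ge0 => y _; rewrite lee_fin cl1_ge0.
- apply: (measurable_fun_fubini_tonelli_F (fun p => (cl1 (K f g p))%:E)).
    by apply/measurable_EFinP; apply: measurable_cl1; exact: mK.
  by move=> x; rewrite lee_fin cl1_ge0.
- by apply: filterS ae => z iz _; exact: cl1_cintegral iz.
Qed.

(** Invariance is assumed for nonnegative functions; positive and negative parts of the real and
    imaginary parts carry it over to complex ones. *)
Lemma cintegral_sb f y : l1_integrable mu f ->
  l1_integrable mu (fun z => f (sb z y)) /\
  cintegral mu (fun z => f (sb z y)) = cintegral mu f.
Proof.
move=> /l1_integrableP[[mr mi] nf].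
have my : measurable_fun setT (fun z => sb z y).
  exact: (measurableT_comp msb (measurable_pair2 y)).
split.
  apply/l1_integrableP; split.
    by split; [exact: (measurableT_comp mr my)|exact: (measurableT_comp mi my)].
  rewrite /l1_norm (@sb_inv (fun z => (cl1 (f z))%:E))//.
    by apply/measurable_EFinP; exact: measurable_cl1.
  by move=> x; rewrite lee_fin cl1_ge0.
have E (p : G -> R) : measurable_fun setT p ->
    (\int[mu]_z p (sb z y) = \int[mu]_z p z)%R.
  move=> mp; have /measurable_EFinP mp' := mp.
  rewrite /Rintegral; congr fine; rewrite integralE [RHS]integralE; congr (_ - _)%E.
    rewrite -(@sb_inv ((EFin \o p)^\+%E) y (measurable_funepos mp') (fun x => funepos_ge0 _ x)).
    by apply: eq_integral => z _; rewrite !funeposE.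
  rewrite -(@sb_inv ((EFin \o p)^\-%E) y (measurable_funeneg mp') (fun x => funeneg_ge0 _ x)).
    by apply: eq_integral => z _; rewrite !funenegE.
by rewrite /cintegral (E _ mr) (E _ mi).
Qed.

(** After the integrals are exchanged, [e z = e (sb z y) * e y] splits the kernel into a translate
    of [f * e] and the factor [g y * e y]; invariance then makes the inner integral independent of
    [y]. *)
Lemma cintegral_conv f g e (C : R) : l1_integrable mu f -> l1_integrable mu g ->
  cmeasurable e -> (forall z, cl1 (e z) <= C) ->
  (forall z y, e z = e (sb z y) * e y) ->
  cintegral mu (fun z => conv f g z * e z) =
  cintegral mu (fun z => f z * e z) * cintegral mu (fun z => g z * e z).
Proof.
move=> fi gi me eC eM.
have [mer mei] := me.
have mc := ((l1_integrableP mu _).1 (conv_integrable fi gi)).1.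
have Ki := conv_kernel_integrable fi gi.
pose H p := f (sb p.1 p.2) * g p.2 * e p.1.
have Hi : l1_integrable (mu \x mu)%E H.
  apply: (l1_integrableMb Ki (C := C)); last by move=> x; exact: eC.
  by split; [exact: (measurableT_comp mer measurable_fst)
            |exact: (measurableT_comp mei measurable_fst)].
have [aeK _ _] := cintegral_fubini Ki.
have [_ iH swap] := cintegral_fubini Hi.
have fei := l1_integrableMb fi me eC; have gei := l1_integrableMb gi me eC.
transitivity (cintegral mu (fun z => cintegral mu (fun y => H (z, y)))).
  (* The factor [e z] can be moved under the inner integral only where the kernel is integrable,
     that is, for almost every [z]. *)
  apply: ae_eq_cintegral.
  - exact: cmeasurableM.
  - exact: ((l1_integrableP mu _).1 iH).1.
  - apply: filterS aeK => z iz; rewrite /conv mulrC -cintegralZ//.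
    by apply: eq_cintegral => y; rewrite /H/= mulrC.
rewrite swap.
transitivity (cintegral mu (fun y =>
    cintegral mu (fun z => f z * e z) * (g y * e y))); last first.
  by rewrite cintegralZ.
apply: eq_cintegral => y.
have [si <-] := cintegral_sb y fei.
rewrite mulrC -cintegralZ//; apply: eq_cintegral => z.
by rewrite /H/= (eM z y); ring.
Qed.

End Convolution.

(** * The power series solution *)

Section FourierCoefficients.
Context {d : measure_display} {G : measurableType d} {R : realType}.
Variable mu : {sigma_finite_measure set G -> \bar R}.
Variable sb : G -> G -> G.
Hypothesis msb : measurable_fun setT (fun p : G * G => sb p.1 p.2).
Hypothesis sb_inv : forall (f : G -> \bar R) y, measurable_fun setT f ->
  (forall x, 0 <= f x)%E -> (\int[mu]_z f (sb z y) = \int[mu]_z f z)%E.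
Variable h : G -> R[i].
Hypothesis mh : cmeasurable h.
Hypothesis h1 : forall z w, cl1 (h z * w) <= cl1 w.
Variable W0 : G -> R[i].
Hypothesis W0i : l1_integrable mu W0.
Variable b : R.
Hypothesis W0b : (l1_norm mu W0 <= b%:E)%E.

Let hM f : l1_integrable mu f -> l1_integrable mu (fun y => h y * f y) /\
  (l1_norm mu (fun y => h y * f y)%R <= l1_norm mu f)%E.
Proof.
move=> /l1_integrableP[mf nf].
have le : (l1_norm mu (fun y => h y * f y)%R <= l1_norm mu f)%E.
  by apply: le_l1_norm => //; exact: cmeasurableM.
split=> //; apply/l1_integrableP; split; first exact: cmeasurableM.
exact: le_lt_trans le nf.
Qed.

(* [coef_upto n k] is the coefficient of [tau ^ k] for [k <= n]; indices [k > n]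
   carry no meaning. *)
Fixpoint coef_upto (n : nat) : nat -> G -> R[i] :=
  if n is m.+1 then fun k =>
    if (k <= m)%N then coef_upto m k
    else fun z => (m.+1%:R^-1)%:C * \sum_(j < m.+1)
      conv mu sb (coef_upto m j) (fun y => h y * coef_upto m (m - j)%N y) z
  else fun=> W0.

Definition coef n := coef_upto n n.

Lemma coef_uptoE n k : (k <= n)%N -> coef_upto n k = coef k.
Proof.
elim: n => [|n IH]; first by rewrite leqn0 => /eqP ->.
rewrite leq_eqVlt ltnS => /predU1P[->//|kn].
by rewrite /= kn IH.
Qed.

Lemma coefS n z : coef n.+1 z = (n.+1%:R^-1)%:C *
  \sum_(j < n.+1) conv mu sb (coef j) (fun y => h y * coef (n - j)%N y) z.
Proof.
rewrite /coef/= ltnn; congr (_ * _); apply: eq_bigr => j _.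
have jn : (j <= n)%N by rewrite -ltnS.
by rewrite (coef_uptoE jn) (coef_uptoE (leq_subr j n)).
Qed.

(** Each of the [n.+1] convolutions has norm at most [b ^ j.+1 * b ^ (n - j).+1 = b ^ n.+2],
    whatever [j] is, and the prefactor [1 / n.+1] turns their sum into an average. No combinatorial
    constant accumulates. *)
Lemma coef_bound n :
  l1_integrable mu (coef n) /\ (l1_norm mu (coef n) <= (b ^+ n.+1)%:E)%E.
Proof.
elim/ltn_ind : n => -[|n] IH; first by rewrite expr1.
pose t (j : 'I_n.+1) := conv mu sb (coef j) (fun y => h y * coef (n - j)%N y).
have ti j : l1_integrable mu (t j).
  apply: conv_integrable => //; first by have [] := IH j (ltn_ord j).
  by apply: (hM _).1; have [] := IH (n - j)%N; rewrite ?ltnS ?leq_subr.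
have tb j : (l1_norm mu (t j) <= (b ^+ n.+2)%:E)%E.
  have [i1 n1] := IH j (ltn_ord j).
  have [i2 n2] : l1_integrable mu (coef (n - j)%N) /\
      (l1_norm mu (coef (n - j)%N) <= (b ^+ (n - j).+1)%:E)%E.
    by apply: IH; rewrite ltnS leq_subr.
  have [i3 n3] := hM i2.
  apply: le_trans (conv_norm msb sb_inv i1 i3) _.
  rewrite (_ : b ^+ n.+2 = b ^+ j.+1 * b ^+ (n - j).+1); last first.
    by rewrite -exprD; congr (_ ^+ _); rewrite addSn addnS subnKC// -ltnS.
  rewrite EFinM; apply: lee_pmul => //; rewrite ?l1_norm_ge0//.
  exact: le_trans n3 n2.
have cE : coef n.+1 = (fun z => (n.+1%:R^-1)%:C * \sum_(j < n.+1) t j z).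
  by apply/funext => z; rewrite coefS.
have [si sn] := l1_norm_sum ti.
have ms := ((l1_integrableP mu _).1 si).1.
have nE : (l1_norm mu (coef n.+1) <= (b ^+ n.+2)%:E)%E.
  rewrite cE l1_norm_real// ger0_norm ?invr_ge0//.
  apply: (@le_trans _ _ ((n.+1%:R^-1)%:E * \sum_(j < n.+1) (b ^+ n.+2)%:E)%E).
    rewrite lee_wpmul2l// ?lee_fin ?invr_ge0//.
    by apply: le_trans sn _; exact: lee_sum.
  rewrite sumEFin -EFinM lee_fin sumr_const card_ord -[X in _ * X]mulr_natl mulrA mulVf ?mul1r//.
split=> //; apply/l1_integrableP; split.
  by rewrite cE; apply: cmeasurableM => //; exact: cmeasurable_cst.
by apply: le_lt_trans nE _; rewrite ltry.
Qed.

Lemma coef_integrable n : l1_integrable mu (coef n).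
Proof. by have [] := coef_bound n. Qed.

(** Pairing with a character gives the scalar recurrence demanded by [mild_cpseries]. The symbol [h]
    is moved from the coefficient to the character, so that both factors pair the same sequence
    [coef] with a bounded kernel. *)
Lemma cintegral_coefS (e : G -> R[i]) (C : R) n :
  cmeasurable e -> (forall z, cl1 (e z) <= C) ->
  (forall z y, e z = e (sb z y) * e y) ->
  (n.+1%:R)%:C * cintegral mu (fun z => coef n.+1 z * e z) =
  \sum_(j < n.+1) cintegral mu (fun z => coef j z * e z) *
     cintegral mu (fun z => coef (n - j)%N z * (h z * e z)).
Proof.
move=> me eC eM.
pose t (j : 'I_n.+1) z :=
  conv mu sb (coef j) (fun y => h y * coef (n - j)%N y) z * e z.
have ti j : l1_integrable mu (t j).
  apply: (l1_integrableMb _ me eC); apply: conv_integrable => //.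
    exact: coef_integrable.
  exact: (hM (coef_integrable _)).1.
transitivity (\sum_(j < n.+1) cintegral mu (t j)); last first.
  apply: eq_bigr => j _; rewrite /t (cintegral_conv msb sb_inv _ _ me eC eM).
  - by congr (_ * _); apply: eq_cintegral => z; ring.
  - exact: coef_integrable.
  - exact: (hM (coef_integrable _)).1.
rewrite -cintegral_sum// -cintegralZ; last first.
  exact: l1_integrableMb (coef_integrable _) me eC.
apply: eq_cintegral => z; rewrite coefS /t -mulr_suml !mulrA -rmorphM/= mulfV ?mul1r//.
Qed.

End FourierCoefficients.

(** * Suprema over time, and limits under the integral *)

Section RationalSup.
Variable R : realType.

Lemma cvg_norm_le (u : nat -> R) (l M : R) : u @ \oo --> l ->
  (forall n, `|u n| <= M) -> `|l| <= M.
Proof.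
move=> /cvg_norm ul uM; rewrite -(cvg_lim _ ul)//.
by apply: limr_le; [exact: cvgP ul|exact: nearW].
Qed.

(** An enumeration of the nonnegative rationals, with repetitions; codes that decode to no rational
    give 0. *)
Definition nnrat (n : nat) : R := `|ratr (odflt 0 (unpickle n : option rat))|.

Lemma nnrat_ge0 n : 0 <= nnrat n. Proof. exact: normr_ge0. Qed.

(** Continuity lets rational times approximate all others. A countable supremum of measurable
    functions of the frequency is measurable, which an uncountable one need not be. *)
Lemma ereal_sup_nnrat (f : R -> R) :
  (forall t, 0 <= t -> {for t, continuous f}) ->
  ereal_sup [set (f t)%:E | t in `[0, +oo[%classic] =
  ereal_sup (range (fun n => (f (nnrat n))%:E)).
Proof.
move=> cf; apply/eqP; rewrite eq_le; apply/andP; split.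
  apply: ge_ereal_sup => _ [t /= + <-]; rewrite in_itv/= andbT => t0.
  rewrite leNgt; apply/negP => lt.
  set v := ereal_sup _ in lt.
  have [r vr rt] : exists2 r : R, (v <= r%:E)%E & r < f t.
    move: lt; case: v => [r rt|//|_]; first by exists r => //; rewrite -lte_fin.
    by exists (f t - 1); [rewrite leNye|lra].
  have : \forall s \near t, r < f s by exact: cvgr_gt (cf t t0) _ rt.
  move=> [e /= e0 te].
  (* The rational is taken to the right of [t], so that it is nonnegative and occurs among the
     [nnrat n]. *)
  have [q /andP[tq qe]] : exists q : rat, t < ratr q < t + e.
    have te' : t < t + e by rewrite ltrDl.
    by have [q] := rat_in_itvoo te'; rewrite in_itv/=; exists q.
  have : ((f (ratr q))%:E <= v)%E.
    apply: ereal_sup_ubound; exists (pickle q) => //.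
    by rewrite /nnrat pickleK/= ger0_norm// (le_trans t0)// ltW.
  move=> /le_trans/(_ vr); rewrite lee_fin leNgt => /negP; apply.
  apply: te; rewrite /ball_ /= ltr_norml; lra.
apply: le_ereal_sup => _ [n _ <-]; exists (nnrat n) => //.
by rewrite /= in_itv/= nnrat_ge0.
Qed.

End RationalSup.

Lemma measurable_cmod {d : measure_display} {T : measurableType d} {R : realType}
  (f : T -> R[i]) : cmeasurable f -> measurable_fun setT (fun x => cmod (f x)).
Proof.
move=> [mr mi]; apply: (measurableT_comp (f := @Num.sqrt R)).
  by apply: continuous_measurable_fun; exact: sqrt_continuous.
by apply: measurable_funD; apply: measurable_funX.
Qed.

Section DominatedConvergence.
Context {d : measure_display} {T : measurableType d} {R : realType}.
Variable mu : {measure set T -> \bar R}.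

Lemma Rintegral_dominated_cvg (f_ : nat -> T -> R) (f g : T -> R) :
  (forall n, measurable_fun setT (f_ n)) ->
  (forall x, f_ ^~ x @ \oo --> f x) ->
  mu.-integrable setT (EFin \o g) ->
  (forall n x, `|f_ n x| <= g x) ->
  mu.-integrable setT (EFin \o f) /\
  (fun n => \int[mu]_x f_ n x)%R @ \oo --> (\int[mu]_x f x)%R.
Proof.
move=> mf_ f_f ig f_g.
have mf : measurable_fun setT f by apply: (measurable_fun_cvg mf_) => x _; exact: f_f.
have [] := @dominated_convergence _ _ _ mu setT measurableT (fun n => EFin \o f_ n)
    (EFin \o f) (EFin \o g).
- by move=> n; exact/measurable_EFinP.
- exact/measurable_EFinP.
- by apply: aeW => x _ /=; apply: cvg_EFin; [exact: nearW|exact: f_f].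
- exact: ig.
- by apply: aeW => x n _ /=; rewrite lee_fin.
move=> fi _ c; split=> //.
apply: (fine_cvg (f := fun n => \int[mu]_x (f_ n x)%:E)%E).
rewrite fineK//; exact: integrable_fin_num.
Qed.

Lemma cintegral_dominated_cvg (f_ : nat -> T -> R[i]) (f : T -> R[i]) (g : T -> R) :
  (forall n, cmeasurable (f_ n)) ->
  (forall x, (fun n => complex.Re (f_ n x)) @ \oo --> complex.Re (f x)) ->
  (forall x, (fun n => complex.Im (f_ n x)) @ \oo --> complex.Im (f x)) ->
  mu.-integrable setT (EFin \o g) ->
  (forall n x, cl1 (f_ n x) <= g x) ->
  [/\ l1_integrable mu f,
     (fun n => complex.Re (cintegral mu (f_ n))) @ \oo --> complex.Re (cintegral mu f) &
     (fun n => complex.Im (cintegral mu (f_ n))) @ \oo --> complex.Im (cintegral mu f)].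
Proof.
move=> mf_ cr ci ig f_g.
have [ir er] := Rintegral_dominated_cvg (fun n => (mf_ n).1) cr ig
  (fun n x => le_trans (ler_wpDr (normr_ge0 _) (lexx _)) (f_g n x)).
have [ii ei] := Rintegral_dominated_cvg (fun n => (mf_ n).2) ci ig
  (fun n x => le_trans (ler_wpDl (normr_ge0 _) (lexx _)) (f_g n x)).
by split.
Qed.

End DominatedConvergence.

(** [supTR] and [supTS] unfold to this same expression, so results about it serve the line and the
    circle alike. *)
Definition sup_time {T : Type} {R : realType} (W : T -> R -> R[i]) (z : T) : \bar R :=
  ereal_sup [set (cmod (W z t))%:E | t in `[0, +oo[%classic].

(** * Summation of the series at each frequency *)

Section SeriesSolution.
Context {d : measure_display} {G : measurableType d} {R : realType}.
Variable mu : {sigma_finite_measure set G -> \bar R}.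
Variables (nu b : R) (a : nat -> G -> R[i]).
Hypotheses (b0 : 0 < b) (bnu : b < nu).
Hypothesis ai : forall n, l1_integrable mu (a n).
Hypothesis ab : forall n, (l1_norm mu (a n) <= (b ^+ n.+1)%:E)%E.

Let nu0 : 0 < nu. Proof. exact: lt_trans bnu. Qed.

Let ma n : cmeasurable (a n). Proof. exact: ((l1_integrableP mu _).1 (ai n)).1. Qed.

(** As [tau < 1 / nu] at all times, this one function of the frequency dominates every partial sum
    of the series in [tau], uniformly in time. *)
Definition majorant (z : G) : \bar R :=
  (\sum_(0 <= n <oo) (cl1 (a n z) * (nu^-1) ^+ n)%:E)%E.

Let term_ge0 n z : 0 <= cl1 (a n z) * (nu^-1) ^+ n.
Proof. by rewrite mulr_ge0 ?cl1_ge0// exprn_ge0// invr_ge0 ltW. Qed.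

Lemma measurable_term n : measurable_fun setT (fun z => (cl1 (a n z) * (nu^-1) ^+ n)%:E).
Proof.
by apply/measurable_EFinP; apply: measurable_funM => //; exact: measurable_cl1.
Qed.

Lemma majorant_ge0 z : (0 <= majorant z)%E.
Proof. by apply: nneseries_ge0 => n _ _; rewrite lee_fin. Qed.

Lemma measurable_majorant : measurable_fun setT majorant.
Proof.
apply: ge0_emeasurable_sum => //.
- by move=> n z _ _; rewrite lee_fin.
- by move=> n _; exact: measurable_term.
Qed.

(** Integrating term by term bounds the integral by the sum of [b ^ n.+1 / nu ^ n], which is
    [b / (1 - b / nu)]; convergence of this geometric series rests on [b < nu]. *)
Lemma majorant_integrable : mu.-integrable setT majorant.
Proof.
apply/integrableP; split; first exact: measurable_majorant.
under eq_integral do rewrite gee0_abs ?majorant_ge0//.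
rewrite integral_nneseries//; last 2 first.
- exact: measurable_term.
- by move=> n z _; rewrite lee_fin.
have q1 : `|b / nu| < 1.
  by rewrite ger0_norm ?divr_ge0 ?ltW// ltr_pdivrMr// mul1r.
apply: (@le_lt_trans _ _ (b / (1 - b / nu))%:E); last by rewrite ltry.
apply: lime_le.
  by apply: is_cvg_nneseries => n _ _; apply: integral_ge0 => z _; rewrite lee_fin.
apply: nearW => N.
apply: (@le_trans _ _ (\sum_(0 <= n < N) (geometric b (b / nu) n)%:E)%E).
  apply: lee_sum => n _.
  under eq_integral do rewrite mulrC EFinM.
  rewrite ge0_integralZl//; last 3 first.
  - by apply/measurable_EFinP; exact: measurable_cl1.
  - by move=> z _; rewrite lee_fin cl1_ge0.
  - by rewrite lee_fin exprn_ge0// invr_ge0 ltW.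
  apply: (@le_trans _ _ ((nu^-1 ^+ n)%:E * (b ^+ n.+1)%:E)%E).
    apply: lee_wpmul2l; first by rewrite lee_fin exprn_ge0// invr_ge0 ltW.
    exact: ab.
  by rewrite -EFinM lee_fin /geometric/= exprMn exprS mulrC -mulrA.
rewrite sumEFin lee_fin.
have -> : b / (1 - b / nu) = limn (series (geometric b (b / nu))).
  by apply/esym/cvg_lim => //; exact: cvg_geometric_series.
apply: (@nondecreasing_cvgn_le _ (series (geometric b (b / nu)))).
  apply: nondecreasing_series => n _ _.
  by rewrite /geometric/= mulr_ge0 ?exprn_ge0 ?divr_ge0 ?ltW.
exact: is_cvg_geometric_series.
Qed.

(* Where the majorant is infinite, [fine] makes it [0] and the truncated
   coefficients below vanish, so the bounds hold at every point. *)
Definition rmajorant (z : G) : R := fine (majorant z).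

Definition tcoef n (z : G) : R[i] := if (majorant z < +oo)%E then a n z else 0.

Lemma rmajorant_integrable : mu.-integrable setT (EFin \o rmajorant).
Proof. exact: (fine_integral majorant_integrable).1. Qed.

Lemma tcoef_sum_le N z : \sum_(n < N) cl1 (tcoef n z) * (nu^-1) ^+ n <= rmajorant z.
Proof.
rewrite /rmajorant; case: (boolP (majorant z < +oo)%E) => zoo.
  have tE n : tcoef n z = a n z by rewrite /tcoef zoo.
  under eq_bigr do rewrite tE.
  rewrite -lee_fin fineK; last by rewrite ge0_fin_numE// majorant_ge0.
  rewrite -sumEFin -(big_mkord xpredT (fun n => (cl1 (a n z) * (nu^-1) ^+ n)%:E)).
  by apply: nneseries_lim_ge => n _ _; rewrite lee_fin.
have tE n : tcoef n z = 0 by rewrite /tcoef (negbTE zoo).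
move: zoo; rewrite -leNgt leye_eq => /eqP ->.
by rewrite big1// => n _; rewrite tE /cl1/= normr0 addr0 mul0r.
Qed.

Lemma tcoef_le n z : cl1 (tcoef n z) <= rmajorant z * nu ^+ n.
Proof.
have := tcoef_sum_le n.+1 z; rewrite big_ord_recr/=.
set s := \sum_(_ < _) _ => h.
have s0 : 0 <= s.
  by apply: sumr_ge0 => i _; rewrite mulr_ge0 ?cl1_ge0// exprn_ge0// invr_ge0 ltW.
have : cl1 (tcoef n z) * nu^-1 ^+ n <= rmajorant z by lra.
by rewrite exprVn ler_pdivrMr// exprn_gt0.
Qed.

Lemma measurable_tcoef n : cmeasurable (tcoef n).
Proof.
have mb : measurable_fun setT (fun z => (majorant z < +oo)%E).
  by apply: measurable_fun_lte => //; exact: measurable_majorant.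
have [mr mi] := ma n; split.
  rewrite (_ : (fun z => _) = (fun z => if (majorant z < +oo)%E
     then complex.Re (a n z) else 0)).
    exact: measurable_fun_ifT.
  by apply/funext => z; rewrite /tcoef; case: ifPn.
rewrite (_ : (fun z => _) = (fun z => if (majorant z < +oo)%E
   then complex.Im (a n z) else 0)).
  exact: measurable_fun_ifT.
by apply/funext => z; rewrite /tcoef; case: ifPn.
Qed.

Lemma tcoef_integrable n : l1_integrable mu (tcoef n).
Proof.
apply/l1_integrableP; split; first exact: measurable_tcoef.
apply: le_lt_trans ((l1_integrableP mu _).1 (ai n)).2.
apply: le_l1_norm => //; first exact: measurable_tcoef.
move=> z; rewrite /tcoef; case: ifPn => // _.
by rewrite {1}/cl1/= normr0 addr0 cl1_ge0.
Qed.

Lemma tcoef_ae n : {ae mu, forall z, tcoef n z = a n z}.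
Proof.
apply: filterS (integrable_ae measurableT majorant_integrable) => z /(_ I).
by rewrite ge0_fin_numE ?majorant_ge0// /tcoef => ->.
Qed.

(** The ratio [b] governs the norms only. At a fixed frequency what survives is summability against
    [nu ^ (- n)], with a constant depending on [z]; hence the ratio [nu], which [tau_lt1] still
    admits. *)
Lemma geo_bounded_tcoef z : geo_bounded nu (fun n => complex.Re (tcoef n z)) /\
  geo_bounded nu (fun n => complex.Im (tcoef n z)).
Proof.
split; exists (rmajorant z) => n; apply: le_trans (tcoef_le n z); rewrite /cl1.
  by rewrite lerDl.
by rewrite lerDr.
Qed.

Definition sol (z : G) (t : R) : R[i] :=
  (expR (- nu * t))%:C * cpseries (tcoef ^~ z) (tau nu t).

Let partial x N z : R[i] := \sum_(n < N) (x ^+ n)%:C * tcoef n z.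

Let Re_partial x N z : complex.Re (partial x N z) =
  pseries (fun n => complex.Re (tcoef n z)) x N.
Proof.
rewrite /partial raddf_sum /pseries/series/= big_mkord; apply: eq_bigr => n _.
by case: (tcoef n z) => p q /=; ring.
Qed.

Let Im_partial x N z : complex.Im (partial x N z) =
  pseries (fun n => complex.Im (tcoef n z)) x N.
Proof.
rewrite /partial raddf_sum /pseries/series/= big_mkord; apply: eq_bigr => n _.
by case: (tcoef n z) => p q /=; ring.
Qed.

Let cvg_partial t z : 0 <= t ->
  (fun N => complex.Re (partial (tau nu t) N z)) @ \oo -->
    complex.Re (cpseries (tcoef ^~ z) (tau nu t)) /\
  (fun N => complex.Im (partial (tau nu t) N z)) @ \oo -->
    complex.Im (cpseries (tcoef ^~ z) (tau nu t)).
Proof.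
move=> t0; have [gr gi] := geo_bounded_tcoef z.
have l1 := tau_lt1 nu0 (lexx nu) t0.
split.
  rewrite (eq_cvg _ _ (fun N => Re_partial _ N z)).
  exact: (geo_bounded_cvg_pseries (ltW nu0) l1 gr).
rewrite (eq_cvg _ _ (fun N => Im_partial _ N z)).
exact: (geo_bounded_cvg_pseries (ltW nu0) l1 gi).
Qed.

Let partial_le t N z : 0 <= t -> cl1 (partial (tau nu t) N z) <= rmajorant z.
Proof.
move=> t0; apply: le_trans (tcoef_sum_le N z); apply: le_trans (cl1_sum _ _ _) _.
have /andP[u0 u1] := tau_itv nu0 t0.
apply: ler_sum => n _; rewrite cl1_real mulrC ler_wpM2l ?cl1_ge0//.
by rewrite ger0_norm ?exprn_ge0// lerXn2r ?nnegrE// ?invr_ge0 ltW.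
Qed.

Let measurable_partial x N : cmeasurable (partial x N).
Proof.
rewrite /partial; elim: N => [|N IH].
  rewrite (_ : (fun z => _) = fun=> 0); first exact: cmeasurable_cst.
  by apply/funext => z; rewrite big_ord0.
rewrite (_ : (fun z => _) = fun z => \sum_(n < N) (x ^+ n)%:C * tcoef n z +
   (x ^+ N)%:C * tcoef N z); last by apply/funext => z; rewrite big_ord_recr.
apply: cmeasurableD => //; apply: cmeasurableM; first exact: cmeasurable_cst.
exact: measurable_tcoef.
Qed.

(** Dominated convergence with the bound [rmajorant z * C] exchanges the series with the integral;
    under each integral the truncated coefficient may then be replaced by [a n], to which it is
    equal almost everywhere. *)
Lemma cintegral_sol (k : G -> R[i]) (C t : R) : 0 <= t ->
  cmeasurable k -> (forall z, cl1 (k z) <= C) ->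
  l1_integrable mu (fun z => sol z t * k z) /\
  cintegral mu (fun z => sol z t * k z) = (expR (- nu * t))%:C *
    cpseries (fun n => cintegral mu (fun z => a n z * k z)) (tau nu t).
Proof.
move=> t0 mk kC.
pose P N z := partial (tau nu t) N z * k z.
pose F z := cpseries (tcoef ^~ z) (tau nu t) * k z.
have [|||||iF cr ci] := @cintegral_dominated_cvg _ _ _ mu P F (fun z => rmajorant z * C).
- by move=> N; apply: cmeasurableM => //; exact: measurable_partial.
- move=> z; have [cr ci] := cvg_partial z t0.
  rewrite /P /F; case: (k z) => p q.
  rewrite (_ : (fun n => _) = (fun n => complex.Re (partial (tau nu t) n z) * p
     - complex.Im (partial (tau nu t) n z) * q)); last first.
    by apply/funext => n; case: (partial _ n z).
  rewrite /=; apply: cvgB; apply: cvgM => //; exact: cvg_cst.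
- move=> z; have [cr ci] := cvg_partial z t0.
  rewrite /P /F; case: (k z) => p q.
  rewrite (_ : (fun n => _) = (fun n => complex.Re (partial (tau nu t) n z) * q
     + complex.Im (partial (tau nu t) n z) * p)); last first.
    by apply/funext => n; case: (partial _ n z).
  rewrite /=; apply: cvgD; apply: cvgM => //; exact: cvg_cst.
- exact: (integrableZr measurableT C rmajorant_integrable).
- by move=> n z; rewrite (le_trans (cl1M _ _))// ler_pM ?cl1_ge0// partial_le.
have aE n : cintegral mu (fun z => tcoef n z * k z) = cintegral mu (fun z => a n z * k z).
  apply: ae_eq_cintegral; [|exact: cmeasurableM|].
    by apply: cmeasurableM => //; exact: measurable_tcoef.
  by apply: filterS (tcoef_ae n) => z ->.
have tki n : l1_integrable mu (fun z => tcoef n z * k z).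
  exact: l1_integrableMb (tcoef_integrable n) mk kC.
have PE N : cintegral mu (P N) =
    \sum_(n < N) ((tau nu t) ^+ n)%:C * cintegral mu (fun z => a n z * k z).
  transitivity (\sum_(n < N) cintegral mu (fun z => ((tau nu t) ^+ n)%:C * (tcoef n z * k z))).
    rewrite -cintegral_sum.
      by apply: eq_cintegral => z; rewrite /P /partial mulr_suml; apply: eq_bigr => n _; rewrite mulrA.
    by move=> j; exact: l1_integrableZ.
  by apply: eq_bigr => n _; rewrite cintegralZ// aE.
have FE : cintegral mu F = cpseries (fun n => cintegral mu (fun z => a n z * k z)) (tau nu t).
  apply/eqP; rewrite eq_complex; apply/andP; split; apply/eqP; rewrite /=; apply/esym/cvg_lim => //.
    rewrite -(eq_cvg _ _ (_ : (fun N => complex.Re (cintegral mu (P N))) =1 _))// => N.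
    rewrite PE raddf_sum /pseries/series/= big_mkord; apply: eq_bigr => n _ /=; ring.
  rewrite -(eq_cvg _ _ (_ : (fun N => complex.Im (cintegral mu (P N))) =1 _))// => N.
  rewrite PE raddf_sum /pseries/series/= big_mkord; apply: eq_bigr => n _ /=; ring.
have -> : (fun z => sol z t * k z) = (fun z => (expR (- nu * t))%:C * F z).
  by apply/funext => z; rewrite /sol /F mulrA.
split; last by rewrite cintegralZ// FE.
exact: l1_integrableZ.
Qed.

Lemma sol_le z t : 0 <= t -> cmod (sol z t) <= 2 * rmajorant z.
Proof.
move=> t0; apply: (le_trans (cmod_le_cl1 _)); rewrite cl1_real.
have e1 : `|expR (- nu * t)| <= 1.
  by rewrite ger0_norm ?expR_ge0// -expR0 ler_expR mulNr oppr_le0 mulr_ge0// ltW.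
(* The limits of the real and imaginary parts are bounded separately, each by [rmajorant z]; hence
   the factor 2. *)
apply: (@le_trans _ _ (1 * (rmajorant z + rmajorant z))); last by lra.
apply: ler_pM => //; first exact: cl1_ge0.
have [cr ci] := cvg_partial z t0.
apply: lerD.
  apply: (cvg_norm_le cr) => N; apply: le_trans (partial_le N z t0).
  by rewrite /cl1 lerDl.
apply: (cvg_norm_le ci) => N; apply: le_trans (partial_le N z t0).
by rewrite /cl1 lerDr.
Qed.

Lemma sol_integrable t : 0 <= t -> l1_integrable mu (sol ^~ t).
Proof.
move=> t0; have [+ _] := cintegral_sol t0 (cmeasurable_cst 1) (fun=> lexx _).
by congr l1_integrable; apply/funext => z; rewrite mulr1.
Qed.

Lemma continuous_cmod_sol z t : 0 <= t ->
  {for t, continuous (fun t => cmod (sol z t))}.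
Proof.
move=> t0; have [gr gi] := geo_bounded_tcoef z.
have ce : {for t, continuous (fun t : R => expR (- nu * t))}.
  apply: continuous_comp; last exact: continuous_expR.
  by apply: cvgM; [exact: cvg_cst|exact: cvg_id].
have cr := continuous_pseries_tau nu0 (lexx nu) t0 gr.
have ci := continuous_pseries_tau nu0 (lexx nu) t0 gi.
rewrite (_ : (fun t => _) = (fun t => Num.sqrt (
  (expR (- nu * t) * limn (pseries (fun n => complex.Re (tcoef n z)) (tau nu t))) ^+ 2 +
  (expR (- nu * t) * limn (pseries (fun n => complex.Im (tcoef n z)) (tau nu t))) ^+ 2))); last first.
  apply/funext => s; rewrite /cmod /sol /cpseries; congr (Num.sqrt (_ ^+ 2 + _ ^+ 2)) => /=; ring.
apply: (continuous_comp (g := @Num.sqrt R)); last exact: sqrt_continuous.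
have sq (u : R -> R) : {for t, continuous u} -> {for t, continuous (fun t => u t ^+ 2)}.
  by move=> cu; rewrite /prop_for /continuous_at; under eq_fun do rewrite expr2; apply: cvgM.
by apply: cvgD; apply: sq; apply: cvgM.
Qed.

Definition sup_sol : G -> \bar R := sup_time sol.

(** Thanks to the truncation the modulus is continuous in time at every frequency, so the supremum
    reduces to the sequence [nnrat]; [esups] from index 0 is the supremum of that whole sequence. *)
Lemma measurable_sup_sol : measurable_fun setT sup_sol.
Proof.
rewrite (_ : sup_sol = (fun z => esups (fun n => (cmod (sol z (nnrat R n)))%:E) 0)).
  apply: measurable_fun_esups => n; apply/measurable_EFinP; apply: measurable_cmod.
  by have [] := (l1_integrableP mu _).1 (sol_integrable (nnrat_ge0 R n)).
apply/funext => z; rewrite /sup_sol /sup_time ereal_sup_nnrat; last first.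
  by move=> t; exact: continuous_cmod_sol.
by rewrite /esups/=; congr ereal_sup; apply/seteqP; split=> _ [n _ <-]; exists n.
Qed.

Lemma integral_sup_sol : (\int[mu]_z sup_sol z < +oo)%E.
Proof.
have ir : mu.-integrable setT (EFin \o (fun z => 2 * rmajorant z)).
  exact: (integrableZl measurableT 2 rmajorant_integrable).
have /integrableP[mr h] := ir.
apply: le_lt_trans h; apply: ge0_le_integral => //.
- move=> z _; apply: (@le_trans _ _ (cmod (sol z 0))%:E).
    by rewrite lee_fin sqrtr_ge0.
  by apply: ereal_sup_ubound; exists 0 => //=; rewrite in_itv/= lexx.
- exact: measurable_sup_sol.
- exact: measurableT_comp.
- move=> z _; apply: ge_ereal_sup => _ [t /= + <-].
  by rewrite in_itv/= andbT => t0; rewrite lee_fin (le_trans (sol_le z t0))// ler_norm.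
Qed.

End SeriesSolution.

Lemma eq_cint_itv (R : realType) (t : R) (F F' : R -> R[i]) :
  (forall s, 0 <= s <= t -> F s = F' s) ->
  cintegrable `[0, t]%classic F -> cintegrable `[0, t]%classic F' /\
  cint `[0, t]%classic F = cint `[0, t]%classic F'.
Proof.
move=> FF' [ir ii]; split.
  by split; [apply: eq_integrable ir => // s|apply: eq_integrable ii => // s];
    rewrite inE/= in_itv/= => st; rewrite FF'.
by rewrite /cint; congr (_%:C + _ * _%:C); apply: eq_Rintegral => s;
  rewrite inE/= in_itv/= => st; rewrite FF'.
Qed.

Lemma geo_bounded_cl1 (R : realType) (b M : R) (A : nat -> R[i]) :
  (forall n, cl1 (A n) <= M * b ^+ n) ->
  geo_bounded b (fun n => complex.Re (A n)) /\
  geo_bounded b (fun n => complex.Im (A n)).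
Proof.
by move=> AM; split; exists M => n; apply: le_trans (AM n); rewrite /cl1 ?lerDl ?lerDr.
Qed.

(** * Existence over an abstract frequency group *)

Section MildSolution.
Context {d : measure_display} {G : measurableType d} {R : realType}.
Variable mu : {sigma_finite_measure set G -> \bar R}.
Variable sb : G -> G -> G.
Hypothesis msb : measurable_fun setT (fun p : G * G => sb p.1 p.2).
Hypothesis sb_inv : forall (f : G -> \bar R) y, measurable_fun setT f ->
  (forall x, 0 <= f x)%E -> (\int[mu]_z f (sb z y) = \int[mu]_z f z)%E.
Variables (X : Type) (e : X -> G -> R[i]) (C : R).
Hypothesis me : forall x, cmeasurable (e x).
Hypothesis eC : forall x z, cl1 (e x z) <= C.
Hypothesis eM : forall x z y, e x z = e x (sb z y) * e x y.
Variable h : G -> R[i].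
Hypothesis mh : cmeasurable h.
Hypothesis h1 : forall z w, cl1 (h z * w) <= cl1 w.

(** [X] stands for physical space, [e x] for the character attached to the point [x], and [h] for
    the symbol of the Hilbert transform. The sequences [A] and [B] in the proof are the series
    coefficients, at [x], of the function and of its Hilbert transform. *)
Theorem exists_mild_solution (nu : R) (W0 : G -> R[i]) : 0 < nu ->
  l1_integrable mu W0 -> (l1_norm mu W0 <= (nu / 2)%:E)%E ->
  exists W : G -> R -> R[i],
  [/\ forall t, 0 <= t -> l1_integrable mu (W ^~ t),
     measurable_fun setT (sup_time W),
     (\int[mu]_z sup_time W z < +oo)%E &
     forall t, 0 <= t -> forall x,
     let F := fun s => (expR (- nu * (t - s)))%:C *
       (cintegral mu (fun z => W z s * e x z) *
        cintegral mu (fun z => h z * W z s * e x z)) in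
     cintegrable `[0, t]%classic F /\
     cintegral mu (fun z => W z t * e x z) =
       (expR (- nu * t))%:C * cintegral mu (fun z => W0 z * e x z) +
       cint `[0, t]%classic F].
Proof.
move=> nu0 W0i W0b.
have b0 : 0 < nu / 2 by lra.
have bnu : nu / 2 < nu by lra.
pose a := coef mu sb h W0.
have ai n : l1_integrable mu (a n) := (coef_bound msb sb_inv mh h1 W0i W0b n).1.
have ab n : (l1_norm mu (a n) <= ((nu / 2) ^+ n.+1)%:E)%E :=
  (coef_bound msb sb_inv mh h1 W0i W0b n).2.
exists (sol nu a); split.
- by move=> t t0; exact: (sol_integrable b0 bnu ai ab t0).
- exact: (measurable_sup_sol b0 bnu ai ab).
- exact: (integral_sup_sol b0 bnu ai ab).
move=> t t0 x.
have mhe : cmeasurable (fun z => h z * e x z) by exact: cmeasurableM.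
have heC z : cl1 (h z * e x z) <= C by exact: le_trans (h1 _ _) (eC x z).
(* The norm of [a n] is bounded by the power [n.+1] of [nu / 2]; the extra power goes into the
   constant. *)
have bnd (k : G -> R[i]) n : cmeasurable k -> (forall z, cl1 (k z) <= C) ->
    cl1 (cintegral mu (fun z => a n z * k z)) <= `|C| * (nu / 2) * (nu / 2) ^+ n.
  move=> mk kC; have ki := l1_integrableMb (ai n) mk kC.
  rewrite -lee_fin; apply: le_trans (cl1_cintegral ki) _.
  have man := ((l1_integrableP mu _).1 (ai n)).1.
  apply: (@le_trans _ _ (l1_norm mu (fun z => C%:C * a n z)%R)).
    apply: le_l1_norm.
    - exact: cmeasurableM.
    - by apply: cmeasurableM => //; exact: cmeasurable_cst.
    move=> z; rewrite cl1_real (le_trans (cl1M _ _))// mulrC ler_wpM2r ?cl1_ge0//.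
    by rewrite (le_trans (kC z))// ler_norm.
  rewrite l1_norm_real// -mulrA -exprS EFinM.
  by apply: lee_wpmul2l; [rewrite lee_fin|exact: ab].
pose A n := cintegral mu (fun z => a n z * e x z).
pose B n := cintegral mu (fun z => a n z * (h z * e x z)).
have [Ar Ai] := geo_bounded_cl1 (fun n => bnd _ n (me x) (eC x) : cl1 (A n) <= _).
have [Br Bi] := geo_bounded_cl1 (fun n => bnd _ n mhe heC : cl1 (B n) <= _).
have AB n : (n.+1%:R)%:C * A n.+1 = \sum_(j < n.+1) A j * B (n - j)%N.
  exact: (cintegral_coefS msb sb_inv mh h1 W0i W0b n (me x) (eC x) (eM x)).
have solA s : 0 <= s -> cintegral mu (fun z => sol nu a z s * e x z) =
    (expR (- nu * s))%:C * cpseries A (tau nu s).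
  by move=> s0; have [] := cintegral_sol b0 bnu ai ab s0 (me x) (eC x).
have solB s : 0 <= s -> cintegral mu (fun z => h z * sol nu a z s * e x z) =
    (expR (- nu * s))%:C * cpseries B (tau nu s).
  move=> s0; have [_ <-] := cintegral_sol b0 bnu ai ab s0 mhe heC.
  by apply: eq_cintegral => z; ring.
have [iF EF] := mild_cpseries b0 bnu t0 Ar Ai Br Bi AB.
move=> F.
have FE s : 0 <= s <= t -> (expR (- nu * (t - s)))%:C *
    ((expR (- nu * s))%:C * cpseries A (tau nu s) *
     ((expR (- nu * s))%:C * cpseries B (tau nu s))) = F s.
  by move=> /andP[s0 _]; rewrite /F solA// solB.
have [iF' <-] := eq_cint_itv FE iF.
by split=> //; rewrite solA.
Qed.

End MildSolution.

(** * The real line *)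

Section RealLine.
Variable R : realType.
Notation lambda := (@lebesgue_measure R).

(** The pushforward under [z - y] gives []a, b]] the length of []a + y, b + y]], and Lebesgue
    measure is determined by its values on such intervals. *)
Lemma lebesgue_integral_translation (f : R -> \bar R) (y : R) :
  measurable_fun setT f -> (forall x, 0 <= f x)%E ->
  (\int[lambda]_z f (z - y)%R = \int[lambda]_z f z)%E.
Proof.
move=> mf f0.
have msub : measurable_fun [set: measurableTypeR R]
    (fun z : measurableTypeR R => (z - y : measurableTypeR R)).
  by apply: measurable_funB.
pose phi_mixin := isMeasurableFun.Build _ _ _ _ _ msub.
pose phi : {mfun measurableTypeR R >-> measurableTypeR R} :=
  HB.pack (fun z : measurableTypeR R => (z - y : measurableTypeR R)) phi_mixin.
transitivity (\int[pushforward lambda phi]_z f z)%E.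
  by rewrite ge0_integral_pushforward.
apply: eq_measure_integral => A mA _.
apply/esym/(@lebesgue_measure_unique _ (pushforward lambda phi)) => // _ [[a b] _ <-] /=.
rewrite /pushforward.
have -> : phi @^-1` `]a, b]%classic = `]a + y, b + y]%classic.
  by apply/seteqP; split=> z /=; rewrite !in_itv/= ltrBrDr lerBlDr.
by rewrite !lebesgue_measure_itv/= !lte_fin ltrD2r -!EFinD; case: ifPn => // _; congr (_%:E); ring.
Qed.

Lemma measurable_cexpi (x : R) : cmeasurable (fun xi : R => cexpi (x * xi)).
Proof.
have mx : measurable_fun setT (fun xi : R => x * xi) by exact: measurable_funM.
split.
  rewrite (_ : (fun xi => _) = (fun xi => cos (x * xi))); last first.
    by apply/funext => xi; rewrite /cexpi complexE.
  apply: (measurableT_comp (f := @cos R)) => //.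
  by apply: continuous_measurable_fun; exact: continuous_cos.
rewrite (_ : (fun xi => _) = (fun xi => sin (x * xi))); last first.
  by apply/funext => xi; rewrite /cexpi complexE.
apply: (measurableT_comp (f := @sin R)) => //.
by apply: continuous_measurable_fun; exact: continuous_sin.
Qed.

Lemma cl1_cexpi (x : R) : cl1 (cexpi x) <= 2.
Proof.
rewrite /cexpi complexE /cl1/=.
have := ler_norml (cos x) 1; have := ler_norml (sin x) 1.
by rewrite !cos_geN1 !cos_le1 sin_geN1 sin_le1/=; lra.
Qed.

Lemma cexpiD (x y : R) : cexpi (x + y) = cexpi x * cexpi y.
Proof.
rewrite /cexpi !complexE cosD sinD; apply/eqP; rewrite eq_complex/=.
by apply/andP; split; apply/eqP => //; rewrite addrC mulrC; congr (_ + _); rewrite mulrC.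
Qed.

(** Multiplication by [- 'i] swaps real and imaginary parts up to sign, which [cl1] does not see. So
    the Hilbert transform is a contraction for [cl1] as well, without loss of a constant. *)
Lemma cl1_hsym (s : R) (w : R[i]) : `|s| <= 1 -> cl1 (- 'i * s%:C * w) <= cl1 w.
Proof.
case: w => p q s1; rewrite /cl1/=.
rewrite !(mul0r, mulr0, oppr0, subr0, add0r, addr0, mulN1r, opprK, mul1r, mulr1, mulNr, sub0r).
by rewrite ?normrN !normrM addrC lerD// -[leRHS]mul1r ler_wpM2r.
Qed.

Lemma l1_norm_le_cmod {d : measure_display} {T : measurableType d}
  (mu : {measure set T -> \bar R}) (f : T -> R[i]) : cmeasurable f ->
  (l1_norm mu f <= 2%:E * \int[mu]_x (cmod (f x))%:E)%E.
Proof.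
move=> mf; have mc := measurable_cmod mf.
rewrite -ge0_integralZl//; last 2 first.
- exact/measurable_EFinP.
- by move=> x _; rewrite lee_fin sqrtr_ge0.
apply: ge0_le_integral => //.
- by move=> x _; rewrite lee_fin cl1_ge0.
- by apply/measurable_EFinP; exact: measurable_cl1.
- by apply/measurable_EFinP; exact: measurable_funM.
- by move=> x _; rewrite -EFinM lee_fin cl1_le_cmod.
Qed.

Lemma measurable_hsymR : cmeasurable (@hsymR R).
Proof.
have ms : measurable_fun setT (fun x : R => Num.sg x).
  rewrite (_ : (fun x => _) = (fun x : R => if 0 < x then 1 else if x < 0 then -1 else 0)).
    apply: measurable_fun_ifT => //; first exact: measurable_fun_ltr.
    by apply: measurable_fun_ifT => //; exact: measurable_fun_ltr.
  by apply/funext => x; case: sgrP => //; rewrite ltxx.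
split.
  by rewrite (_ : (fun x => _) = fun=> 0)//; apply/funext => x; rewrite /hsymR/=; ring.
rewrite (_ : (fun x => _) = (fun x => - Num.sg x)); first exact: measurableT_comp.
by apply/funext => x; rewrite /hsymR/=; ring.
Qed.

Lemma exists_mildR (nu : R) (W0 : R -> R[i]) : 0 < nu ->
  inB0R W0 -> (normB0R W0 < (nu / 4)%:E)%E ->
  exists W : R -> R -> R[i], inBB0R W /\ mildR nu W0 W.
Proof.
move=> nu0 iW0 nW0.
have cintE (f : R -> R[i]) : cint setT f = cintegral lambda f by rewrite /cint complexE.
have W0i : l1_integrable lambda W0 := iW0.
have mW0 := ((l1_integrableP lambda _).1 W0i).1.
have W0b : (l1_norm lambda W0 <= (nu / 2)%:E)%E.
  apply: le_trans (l1_norm_le_cmod lambda mW0) _.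
  rewrite (_ : nu / 2 = 2 * (nu / 4)); last by field.
  by rewrite EFinM; apply: lee_wpmul2l; [rewrite lee_fin|exact: ltW].
have [|||||||W [Wi mW iW WE]] := @exists_mild_solution _ (measurableTypeR R) R lambda
  (fun z y => z - y) _ _ R (fun x xi => cexpi (x * xi)) 2 _ _ _ (@hsymR R) _ _ nu W0 nu0 W0i W0b.
- exact: measurable_funB.
- by move=> f y; exact: lebesgue_integral_translation.
- exact: measurable_cexpi.
- by move=> x z; exact: cl1_cexpi.
- by move=> x z y; rewrite -cexpiD -mulrDr subrK.
- exact: measurable_hsymR.
- by move=> z w; apply: cl1_hsym; rewrite normr_sg; case: (_ != 0).
exists W; split; first by split => //.
move=> t t0 x F; have [iF EF] := WE t t0 x.
have -> : F = (fun s => (expR (- nu * (t - s)))%:C *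
    (cintegral lambda (fun xi => W xi s * cexpi (x * xi)) *
     cintegral lambda (fun xi => hsymR xi * W xi s * cexpi (x * xi)))).
  by apply/funext => s; rewrite /F /omegaR /HomegaR /finvR !cintE.
by split=> //; rewrite /omegaR /finvR !cintE.
Qed.

End RealLine.

(** * The circle *)

HB.instance Definition _ (R : realType) :=
  @Measure_isSigmaFinite.Build _ nat R (@counting nat R) (sigma_finite_counting R).

(* The dual group Z is transported to [nat], which carries the discrete
   measurable structure; the enumeration 0, -1, 1, -2, ... matches the partial
   sums in [zsum]. *)
Definition int_of_code (n : nat) : int := if odd n then Negz n./2 else Posz n./2.

Definition code_of_int (k : int) : nat :=
  match k with Posz n => n.*2 | Negz n => n.*2.+1 end.

Lemma code_of_intK : cancel code_of_int int_of_code.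
Proof.
by case=> n; rewrite /int_of_code/= odd_double ?uphalf_double ?doubleK.
Qed.

Lemma int_of_codeK : cancel int_of_code code_of_int.
Proof.
move=> n; rewrite /int_of_code -[RHS]odd_double_half.
by case: (odd n) => /=; rewrite ?add1n ?add0n.
Qed.

Definition code_sub (m n : nat) : nat := code_of_int (int_of_code m - int_of_code n).

Lemma code_subK n : cancel (code_sub ^~ n)
  (fun m => code_of_int (int_of_code m + int_of_code n)).
Proof. by move=> m; rewrite /code_sub code_of_intK subrK int_of_codeK. Qed.

Lemma code_addK n : cancel (fun m => code_of_int (int_of_code m + int_of_code n))
  (code_sub ^~ n).
Proof. by move=> m; rewrite /code_sub code_of_intK addrK int_of_codeK. Qed.

(** Every set of pairs is a countable union of singletons, and these are rectangles. Hence every map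
    on pairs is measurable, [code_sub] in particular. *)
Lemma measurable_nat2 (A : set (nat * nat)) : measurable A.
Proof.
rewrite (_ : A = \bigcup_i \bigcup_j
    (if (i, j) \in A then [set i] `*` [set j] else set0)).
  apply: bigcup_measurable => i _; apply: bigcup_measurable => j _.
  by case: ifPn => // _; exact: measurableX.
apply/seteqP; split=> [[i j] Aij|[i j] [i' _ [j' _]]].
  by exists i => //; exists j => //; rewrite mem_set.
by case: ifPn => // /set_mem + [/= -> ->].
Qed.

Section Circle.
Variable R : realType.
Notation sharp := (@counting nat R).

(** Nonnegative sums may be reindexed by any bijection; applied to subtraction of a fixed code, this
    is translation invariance on the dual group. *)
Lemma ge0_integral_counting_bij (f : nat -> \bar R) (g g' : nat -> nat) :
  cancel g g' -> cancel g' g -> (forall n, 0 <= f n)%E ->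
  (\int[sharp]_n f (g n) = \int[sharp]_n f n)%E.
Proof.
move=> gK g'K f0; rewrite !ge0_integral_count// !nneseries_esumT//.
rewrite [RHS](@reindex_esum _ _ _ setT setT g)//.
by rewrite setTT_bijective; exists g'.
Qed.

Lemma esum_int_counting (f : int -> \bar R) : (forall k, 0 <= f k)%E ->
  (\esum_(k in [set: int]) f k = \int[sharp]_n f (int_of_code n))%E.
Proof.
move=> f0; rewrite ge0_integral_count// nneseries_esumT//.
apply: reindex_esum; rewrite setTT_bijective.
by exists code_of_int; [exact: int_of_codeK|exact: code_of_intK].
Qed.

Lemma sum_pairs (p : nat -> R) N :
  \sum_(n < N) (p n.*2 + p n.*2.+1) = series p N.*2.
Proof.
elim: N => [|N IH]; first by rewrite big_ord0 /series/= big_geq.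
by rewrite big_ord_recr/= IH doubleS /series/= !big_nat_recr//= addrA.
Qed.

(** Codes [2 n] and [2 n + 1] stand for the frequencies [n] and [- (n + 1)], so the symmetric
    partial sums of [zsum] are the even-indexed partial sums of an absolutely convergent series over
    codes. *)
Lemma lim_pairs_counting (p : nat -> R) : sharp.-integrable setT (EFin \o p) ->
  limn (fun N : nat => \sum_(n < N) (p n.*2 + p n.*2.+1)) = (\int[sharp]_n p n)%R.
Proof.
move=> /integrableP[_]; rewrite ge0_integral_count//= => pfin.
have cp : cvgn (series p) by apply: normed_cvg; exact: (@nnseries_is_cvg _ (fun k => `|p k|)).
have -> : (\int[sharp]_n p n)%R = limn (series p).
  rewrite /Rintegral integral_count; last first.
    by rewrite /summable -nneseries_esumT.
  have c : (fun n => \sum_(0 <= k < n) (p k)%:E)%E @ \oo --> (limn (series p))%:E.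
    under eq_fun do rewrite sumEFin.
    by apply: cvg_EFin; [exact: nearW|exact: cp].
  by rewrite (cvg_lim _ c).
apply: cvg_lim => //; under eq_fun do rewrite sum_pairs.
apply: (cvg_comp (fun N => N.*2) (series p) _ cp).
apply/cvgnyPge => A; near=> n; rewrite -addnn (leq_trans _ (leq_addr _ _))//.
by near: n; exact: nbhs_infty_ge.
Unshelve. all: by end_near. Qed.

Lemma zsum_counting (F : int -> R[i]) :
  l1_integrable sharp (fun n => F (int_of_code n)) ->
  zsum F = cintegral sharp (fun n => F (int_of_code n)).
Proof.
have ev n : int_of_code n.*2 = n%:Z by rewrite /int_of_code odd_double doubleK.
have od n : int_of_code n.*2.+1 = - (n.+1)%:Z.
  by rewrite /int_of_code/= odd_double/= uphalf_double.
move=> [/lim_pairs_counting ir /lim_pairs_counting ii].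
rewrite /zsum complexE /cintegral -ir -ii.
by congr (limn _ +i* limn _); apply/funext => N; apply: eq_bigr => n _; rewrite ev od.
Qed.

Lemma exists_mildS (nu : R) (W0 : int -> R[i]) : 0 < nu ->
  (normB0S W0 < (nu / 4)%:E)%E ->
  exists W : int -> R -> R[i], inBB0S W /\ mildS nu W0 W.
Proof.
move=> nu0 nW0.
pose V0 n := W0 (int_of_code n).
have mnat (f : nat -> R[i]) : cmeasurable f by split=> _ Y mY.
have nV0 : (\int[sharp]_n (cmod (V0 n))%:E < (nu / 4)%:E)%E.
  rewrite -(esum_int_counting (f := fun k => (cmod (W0 k))%:E))//.
  by move=> k; rewrite lee_fin sqrtr_ge0.
have V0b : (l1_norm sharp V0 <= (nu / 2)%:E)%E.
  apply: le_trans (l1_norm_le_cmod sharp (mnat V0)) _.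
  rewrite (_ : nu / 2 = 2 * (nu / 4)); last by field.
  by rewrite EFinM; apply: lee_wpmul2l; [rewrite lee_fin|exact: ltW].
have V0i : l1_integrable sharp V0.
  by apply/l1_integrableP; split=> //; apply: le_lt_trans V0b _; rewrite ltry.
pose e (x : R) (n : nat) : R[i] := cexpi ((int_of_code n)%:~R * x).
have eC x n : cl1 (e x n) <= 2 by exact: cl1_cexpi.
pose h n := @hsymS R (int_of_code n).
have h1 n w : cl1 (h n * w) <= cl1 w.
  by apply: cl1_hsym; rewrite -intr_norm normr_sg; case: (_ != 0).
have [|||||V [Vi mV iV VE]] := @exists_mild_solution _ nat R sharp
  code_sub _ _ R e 2 _ eC _ h _ h1 nu V0 nu0 V0i V0b.
- by move=> _ Y mY; exact: measurable_nat2.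
- move=> f y _ f0.
  exact: (ge0_integral_counting_bij (code_subK y) (code_addK y)).
- by move=> x; exact: mnat.
- by move=> x z y; rewrite /e -cexpiD -mulrDl -intrD code_of_intK subrK.
- exact: mnat.
exists (fun k t => V (code_of_int k) t).
split.
  rewrite /inBB0S esum_int_counting; last first.
    move=> k; apply: (@le_trans _ _ (cmod (V (code_of_int k) 0))%:E); first by rewrite lee_fin sqrtr_ge0.
    by apply: ereal_sup_ubound; exists 0 => //=; rewrite in_itv/= lexx.
  by under eq_integral do rewrite /supTS int_of_codeK.
have fS (f : int -> R[i]) x : l1_integrable sharp (fun n => f (int_of_code n)) ->
    finvS f x = cintegral sharp (fun n => f (int_of_code n) * e x n).
  move=> fi; rewrite /finvS zsum_counting//.
  exact: (l1_integrableMb fi (mnat (e x)) (eC x)).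
have hi (f : nat -> R[i]) : l1_integrable sharp f -> l1_integrable sharp (fun n => h n * f n).
  move=> /l1_integrableP[mf nf]; apply/l1_integrableP; split=> //.
  by apply: le_lt_trans nf; apply: le_l1_norm.
move=> t t0 x F.
have [iF EF] := VE t t0 x.
(* [zsum] is identified with the counting integral for summable families only. Summability of [V] is
   known for [s >= 0], so the integrands are compared on [[0, t]] and not as functions. *)
have oE s : 0 <= s -> omegaS (fun k t => V (code_of_int k) t) x s =
    cintegral sharp (fun n => V n s * e x n).
  move=> s0; rewrite /omegaS fS; under eq_fun do rewrite int_of_codeK//.
    by [].
  exact: Vi.
have hE s : 0 <= s -> HomegaS (fun k t => V (code_of_int k) t) x s =
    cintegral sharp (fun n => h n * V n s * e x n).
  move=> s0; rewrite /HomegaS fS; under eq_fun do rewrite int_of_codeK//.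
    by [].
  exact: (hi _ (Vi s s0)).
have FE s : 0 <= s <= t -> (expR (- nu * (t - s)))%:C *
    (cintegral sharp (fun n => V n s * e x n) *
     cintegral sharp (fun n => h n * V n s * e x n)) = F s.
  by move=> /andP[s0 _]; rewrite /F oE// hE.
have [iF' <-] := eq_cint_itv FE iF.
by split=> //; rewrite oE// EF fS.
Qed.

End Circle.

Theorem theorem2p1 (R : realType) (nu : R) (hnu : 0 < nu) :
  (forall W0 : R -> R[i],
     inB0R W0 -> (normB0R W0 < (nu / 4)%:E)%E ->
     exists W : R -> R -> R[i], inBB0R W /\ mildR nu W0 W) /\
  (forall W0 : int -> R[i],
     (normB0S W0 < (nu / 4)%:E)%E ->
     exists W : int -> R -> R[i], inBB0S W /\ mildS nu W0 W).
Proof.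
by split=> W0; [exact: exists_mildR|exact: exists_mildS].
Qed.
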